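(* Let $\zeta$ be the substitution of constant length $3$ (a $3$-substitution, $d=1$) on $\mathcal A=\{0,1,2\}$ given by $0\mapsto001$, $1\mapsto122$, $2\mapsto210$. Then the spectrum of $\zeta$ is purely singular: the maximal spectral type $\sigma_{\max}$ of the uniquely ergodic subshift $(X_\zeta,T)$ is singular with respect to Lebesgue measure on the circle $\mathbb T$.
   Context: $\zeta$ extends to words by concatenation. $X_\zeta\subset\mathcal A^{\mathbb Z}$ is the set of two-sided sequences all of whose finite subwords occur in some $\zeta^n(\gamma)$, $n\in\mathbb N$, $\gamma\in\mathcal A$, and $T$ is the shift $(TA)(j)=A(j+1)$; $\mu$ denotes the unique $T$-invariant Borel probability measure on $X_\zeta$. For $f\in L^2(\mu)$, $\sigma_f$ is the positive measure on $\mathbb T$ with $\int z^{-k}\,d\sigma_f=\int f\circ T^{-k}\,\overline f\,d\mu$ for $k\in\mathbb Z$. The maximal spectral type $\sigma_{\max}$ is the type (mutual absolute continuity class) of $\sigma_F$ for $F\in L^2(\mu)$ such that $\sigma_f\ll\sigma_F$ for all $f\in L^2(\mu)$. *)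

(* Defs.v *)
From HB Require Import structures.
From mathcomp Require Import all_boot all_order all_algebra.
From mathcomp Require Import all_classical all_reals all_analysis.
From mathcomp Require Import complex.

Set Implicit Arguments.
Unset Strict Implicit.
Unset Printing Implicit Defensive.

Import Order.TTheory GRing.Theory Num.Theory.
Import numFieldNormedType.Exports.

Local Open Scope classical_set_scope.
Local Open Scope ring_scope.
Local Open Scope complex_scope.

Notation letter := 'I_3.

(* The numerals are read in the ring structure of 'I_3, where i%:R is the
   ordinal i. *)
Definition zeta (a : letter) : seq letter :=
  nth [::] [:: [:: 0; 0; 1]; [:: 1; 2; 2]; [:: 2; 1; 0]] a.

Section Subshift.
Variable s : letter -> seq letter.

Definition subst_word (w : seq letter) : seq letter := flatten (map s w).

Definition in_language (w : seq letter) : Prop :=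
  exists (n : nat) (a : letter), infix w (iter n subst_word [:: a]).

Definition window (x : int -> letter) (i : int) (n : nat) : seq letter :=
  [seq x (i + j%:Z) | j <- iota 0 n].

Definition subshift : set (int -> letter) :=
  [set x | forall i n, in_language (window x i n)].

End Subshift.

(* shift k is the k-th iterate T^k (k of either sign) of the left shift
   T = shift 1. *)
Definition shift (k : int) (x : int -> letter) : int -> letter :=
  fun j => x (j + k).

HB.instance Definition _ := isPointed.Build letter ord0.

(* The Borel sets of letter^Z with the product of the discrete topologies. *)
Definition borel_shift :=
  g_sigma_algebraType (@open {ptws int -> discrete_topology letter}).

Definition invariant_on (R : realType) (X : set (int -> letter))
    (mu : probability borel_shift R) : Prop :=
  mu X = 1%E /\
  forall A : set borel_shift, measurable A -> mu (shift 1 @^-1` A) = mu A.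

Section Circle.
Variable R : realType.

Definition circle_set : Type := {z : R[i] | `|z| == 1}.

HB.instance Definition _ := Choice.on circle_set.
HB.instance Definition _ :=
  isPointed.Build circle_set (exist _ (1 : R[i]) (introT eqP (normr1 _))).

Definition circle_coord (z : circle_set) : R * R :=
  (complex.Re (val z), complex.Im (val z)).

(* The trace on the unit circle of the Borel sigma-algebra of R^2. *)
Definition circle := g_sigma_algebra_preimageType circle_coord.

Lemma normc_cos_sin (t : R) : `|cos t +i* sin t| == 1.
Proof. by rewrite normc_def /= cos2Dsin2 sqrtr1. Qed.

Definition expi (t : R) : circle := exist _ (cos t +i* sin t) (normc_cos_sin t).

(* Normalized Lebesgue measure: the image of Lebesgue measure on [0, 1[ by
   t |-> exp(2 i pi t). *)
Definition lebesgue_circle (A : set circle) : \bar R :=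
  lebesgue_measure (`[0, 1[%classic `&` [set t | A (expi (2 * pi * t))]).

End Circle.

(* The real Rintegral is 0 on non-integrable functions; this is harmless below,
   where all integrands are integrable. *)
Definition Cintegral d (T : measurableType d) (R : realType)
    (m : {measure set T -> \bar R}) (f : T -> R[i]) : R[i] :=
  Rintegral m setT (fun x => complex.Re (f x)) +i*
  Rintegral m setT (fun x => complex.Im (f x)).

Definition square_integrable d (T : measurableType d) (R : realType)
    (m : {measure set T -> \bar R}) (f : T -> R[i]) : Prop :=
  [/\ measurable_fun setT (fun x => complex.Re (f x)),
      measurable_fun setT (fun x => complex.Im (f x)) &
      (\int[m]_x ((complex.Re (f x) ^+ 2 + complex.Im (f x) ^+ 2)%:E) < +oo)%E].

Section Spectral.
Variables (R : realType) (mu : probability borel_shift R).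

Definition is_spectral_measure (f : borel_shift -> R[i])
    (sigma : {finite_measure set (circle R) -> \bar R}) : Prop :=
  forall k : int,
    Cintegral sigma (fun z => val z ^ (- k)) =
    Cintegral mu (fun x => f (shift (- k) x) * (f x)^*%C).

(* sigma belongs to the maximal spectral type, i.e. to the mutual absolute
   continuity class of sigma_F for some F such that every sigma_f << sigma_F. *)
Definition in_maximal_spectral_type
    (sigma : {finite_measure set (circle R) -> \bar R}) : Prop :=
  exists (F : borel_shift -> R[i])
         (sigma_F : {finite_measure set (circle R) -> \bar R}),
    [/\ square_integrable mu F,
        is_spectral_measure F sigma_F,
        (forall (f : borel_shift -> R[i])
                (sigma_f : {finite_measure set (circle R) -> \bar R}),
           square_integrable mu f -> is_spectral_measure f sigma_f ->
           sigma_f `<< sigma_F) &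
        sigma `<< sigma_F /\ sigma_F `<< sigma].

End Spectral.

Definition mutually_singular d (T : measurableType d) (R : realType)
    (m1 m2 : set T -> \bar R) : Prop :=
  exists N : set T, [/\ measurable N, m1 N = 0%E & m2 (~` N) = 0%E].

(* Main.v *)
(* The columns of zeta are permutations of the letters that generate S_3, which
   acts 2-transitively. Two letters of a point of the subshift at distance k thus
   agree with an asymptotic frequency alpha_k, alpha_(3k) = alpha_k, and the
   frequency at distance k (3^n - 1) tends to alpha_k^2 + (1 - alpha_k)^2 / 2.
   Expanding a square, this says that on mean-zero functions of one letter the
   averages V of the powers T^(k 3^m) of the shift tend strongly to the scalar
   c = 3/2 (alpha_k - 1/3), while on functions of the odometer coordinate they
   tend to 1. Hence P = (V - 1)(V - c) tends strongly to 0 on the whole of L^2,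
   i.e. P(z) tends to 0 in L^2 of any spectral measure. On the other hand V(z) is
   an average of distinct characters, so it tends to 0 in L^2 of Lebesgue measure,
   where P(z) tends to c. For k = 2, c is not 0, and the set where V(z) tends to 0
   fast along a subsequence separates the two measures. *)
From HB Require Import structures.
From mathcomp Require Import all_boot all_order all_algebra.
From mathcomp Require Import all_classical all_reals all_analysis.
From mathcomp Require Import complex ring lra zify measurable_realfun.
Require Import Defs.

Set Implicit Arguments.
Unset Strict Implicit.
Unset Printing Implicit Defensive.

Import Order.TTheory GRing.Theory Num.Theory.
Import numFieldNormedType.Exports.

Local Open Scope classical_set_scope.
Local Open Scope ring_scope.

(** * The fixed points of the substitution *)

(** The value $\alpha_k^2 + (1-\alpha_k)^2/2$ comes from two scales. In a position $3^n q + r$, a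
    shift by $k3^n$ changes the block $q$ and keeps the offset $r$, while a shift by $k$ stays in
    the block except near its end. Two blocks compared at distance $k$ agree with frequency near
    $\alpha_k$ if their letters are equal and near $(1-\alpha_k)/2$ otherwise, and letters at
    distance $k$ are equal with frequency $\alpha_k$.

    A cylinder function reads several letters. On blocks much longer than its window it becomes, at
    each fixed offset, a function of the block letter alone. This is why the exponents of $V$ are
    also dilated by $3^n$; the dependence on the offset is removed by the factor $V - 1$.

    All frequencies are computed on the three one-sided fixed points. They reach the invariant
    measure through an inequality that loses a factor 3, harmless for quantities that tend to 0, so
    upper limits are enough throughout. *)

Lemma letter_cases (P : letter -> Prop) :
  P 0 -> P 1 -> P 2 -> forall a, P a.
Proof.
move=> P0 P1 P2 [[|[|[|//]]] lt3].
- by have <- : 0 = Ordinal lt3 by exact/val_inj.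
- by have <- : 1 = Ordinal lt3 by exact/val_inj.
- by have <- : 2 = Ordinal lt3 by exact/val_inj.
Qed.

Lemma size_zeta a : size (zeta a) = 3%N.
Proof. by move: a; apply: letter_cases. Qed.

Definition col (t : nat) (a : letter) : letter := nth 0 (zeta a) t.

(** The columns are the identity, the transposition of [1] and [2], and the cycle
    [0 -> 1 -> 2 -> 0]. *)
Lemma col_inj t a b : (t < 3)%N -> (col t a == col t b) = (a == b).
Proof.
by move: t => [|[|[|//]]] _; move: a b;
  apply: letter_cases; apply: letter_cases.
Qed.

Definition iter_zeta n a := iter n (subst_word zeta) [:: a].

Lemma nth_subst_word w i t : (t < 3)%N -> (i < size w)%N ->
  nth 0 (subst_word zeta w) (3 * i + t) = col t (nth 0 w i).
Proof.
move=> t3; elim: w i => [//|b w IH] [|i] /= iw.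
  by rewrite nth_cat size_zeta muln0 add0n t3.
rewrite nth_cat size_zeta ifF; last by lia.
by rewrite -IH//; congr nth; lia.
Qed.

Lemma size_subst_word w : size (subst_word zeta w) = (3 * size w)%N.
Proof.
elim: w => [//|b w IH] /=.
by rewrite size_cat size_zeta -/(subst_word zeta w) IH mulnS.
Qed.

Lemma size_iter_zeta n a : size (iter_zeta n a) = (3 ^ n)%N.
Proof.
elim: n => [//|n IH]; rewrite /iter_zeta iterS.
by rewrite size_subst_word -/(iter_zeta n a) IH expnS.
Qed.

Lemma iter_zeta_rec n a i t : (t < 3)%N -> (i < (3 ^ n)%N)%N ->
  nth 0 (iter_zeta n.+1 a) (3 * i + t) = col t (nth 0 (iter_zeta n a) i).
Proof.
by move=> t3 i3; rewrite /iter_zeta iterS nth_subst_word// size_iter_zeta.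
Qed.

Lemma div3P (i : nat) : exists j t, [/\ (t < 3)%N & i = (3 * j + t)%N].
Proof. by exists (i %/ 3)%N, (i %% 3)%N; split; lia. Qed.

Lemma iter_zeta_prefix n m a i : (n <= m)%N -> (i < (3 ^ n)%N)%N ->
  nth 0 (iter_zeta m a) i = nth 0 (iter_zeta n a) i.
Proof.
move=> /subnK <-; elim: (m - n)%N => [//|d IH] i3.
rewrite -IH// addSn; have {IH} : (i < 3 ^ (d + n))%N.
  by rewrite (leq_trans i3)// leq_exp2l// leq_addl.
elim: (d + n)%N i {i3} => [|k IH] i i3.
  by case: i i3 => // _; move: a; apply: letter_cases.
have [j [t [t3 ij]]] := div3P i; rewrite {}ij in i3 *.
have j3 : (j < 3 ^ k)%N by move: i3; rewrite expnS; lia.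
have j3' : (j < 3 ^ k.+1)%N by rewrite expnS; lia.
by rewrite !iter_zeta_rec// IH.
Qed.

(* Since zeta a starts with a, the words zeta^n(a) are prefixes of one
   another; fixpt a is their common limit. *)
Definition fixpt (a : letter) (i : nat) : letter := nth 0 (iter_zeta i a) i.

Lemma iter_zeta_fixpt n a i : (i < (3 ^ n)%N)%N ->
  nth 0 (iter_zeta n a) i = fixpt a i.
Proof.
move=> i3; rewrite /fixpt; have [ni|ni] := leqP n i.
  by rewrite (iter_zeta_prefix a ni).
by rewrite (iter_zeta_prefix a (ltnW ni))// ltn_expl.
Qed.

Lemma fixpt_rec a i t : (t < 3)%N -> fixpt a (3 * i + t) = col t (fixpt a i).
Proof.
move=> t3; have i3 : (i < 3 ^ i)%N by exact: ltn_expl.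
by rewrite -(@iter_zeta_fixpt i.+1) ?iter_zeta_rec ?iter_zeta_fixpt// expnS; lia.
Qed.

(** Self-similarity: a fixed point of $\zeta$ is fixed by $\zeta^n$, hence is the concatenation of
    the words $\zeta^n$ of its own letters. The induction peels off the last base 3 digit of the
    offset. *)
Lemma fixpt_block n a q i : (i < (3 ^ n)%N)%N ->
  fixpt a (3 ^ n * q + i) = fixpt (fixpt a q) i.
Proof.
elim: n q i => [|n IH] q i i3; first by case: i i3 => //; rewrite addn0 mul1n.
have [j [t [t3 ij]]] := div3P i; rewrite {}ij in i3 *.
have j3 : (j < 3 ^ n)%N by move: i3; rewrite expnS; lia.
have -> : (3 ^ n.+1 * q + (3 * j + t) = 3 * (3 ^ n * q + j) + t)%N.
  by rewrite expnS; lia.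
by rewrite !fixpt_rec// IH.
Qed.

(** The letters at position [i] are the images of [a] and [b] under one composition of columns,
    dictated by the base 3 digits of [i]. *)
Lemma fixpt_eq a b i : (fixpt a i == fixpt b i) = (a == b).
Proof.
elim/ltn_ind: i => i IH; have [j [t [t3 ij]]] := div3P i.
rewrite ij !fixpt_rec// col_inj//; case: (posnP i) => [i0|ipos].
  by have -> : j = 0%N by lia.
by apply: IH; lia.
Qed.

Lemma fixpt_col a t : (t < 3)%N -> fixpt a t = col t a.
Proof. exact: (@fixpt_rec a 0 t). Qed.

(** * Block averages and coincidence frequencies *)

Section Average.
Variable R : realType.
Implicit Types (h g : nat -> R) (n m : nat).

Definition avg n h : R := (3 ^+ n)^-1 * \sum_(0 <= i < (3 ^ n)%N) h i.

Lemma expr3_gt0 n : 0 < 3 ^+ n :> R.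
Proof. by rewrite exprn_gt0. Qed.

Lemma avgD n h g : avg n (fun i => h i + g i) = avg n h + avg n g.
Proof. by rewrite /avg big_split mulrDr. Qed.

Lemma avgZ n x h : avg n (fun i => x * h i) = x * avg n h.
Proof. by rewrite /avg -mulr_sumr mulrCA. Qed.

Lemma avg_sum n (I : Type) (s : seq I) (F : I -> nat -> R) :
  avg n (fun i => \sum_(p <- s) F p i) = \sum_(p <- s) avg n (F p).
Proof. by rewrite /avg exchange_big /= mulr_sumr. Qed.

Lemma avg_cst n x : avg n (fun=> x) = x.
Proof.
by rewrite /avg sumr_const_nat subn0 -[x *+ _]mulr_natl natrX mulrA mulVf ?mul1r//.
Qed.

Lemma ler_avg n h g : (forall i, h i <= g i) -> avg n h <= avg n g.
Proof.
move=> hg; apply: ler_wpM2l; first by rewrite invr_ge0 ltW ?expr3_gt0.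
by apply: ler_sum => i _.
Qed.

Lemma eq_avg n h g : h =1 g -> avg n h = avg n g.
Proof. by move=> hg; congr (_ * _); apply: eq_bigr => i _. Qed.

Lemma big_nat_blocks (p q : nat) h :
  \sum_(0 <= i < (p * q)%N) h i =
  \sum_(0 <= r < p) \sum_(0 <= j < q) h (p * j + r)%N.
Proof.
elim: q => [|q IH]; first by rewrite muln0 big_geq// big1// => r _; rewrite big_geq.
under [RHS]eq_bigr do rewrite big_nat_recr//=.
rewrite big_split -IH /= mulnS addnC (@big_cat_nat _ _ _ (p * q))//= ?leq_addr//.
congr (_ + _).
by rewrite -{1}[(p * q)%N]add0n big_addn addKn; apply: eq_bigr => i _; rewrite addnC.
Qed.

Lemma avg_blocks n m h :
  avg (n + m) h = avg n (fun r => avg m (fun q => h (3 ^ n * q + r)%N)).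
Proof.
rewrite /avg expnD big_nat_blocks exprD invfM -mulrA; congr (_ * _).
by rewrite mulr_sumr.
Qed.

Lemma avg_blocks' n m h :
  avg (n + m) h = avg m (fun q => avg n (fun r => h (3 ^ n * q + r)%N)).
Proof.
rewrite avg_blocks /avg -mulr_sumr -mulr_sumr exchange_big /= !mulrA.
by rewrite [_ * (3 ^+ m)^-1]mulrC.
Qed.

(** Applied where [h] and [g] differ only because a window of length [k] leaves the block of length
    $3^n$; this is the source of the errors $k/3^n$ in the recursions on coincidences. *)
Lemma avg_close n k h g B : (forall i, `|h i - g i| <= B) ->
  (forall i, (i + k < 3 ^ n)%N -> h i = g i) ->
  `|avg n h - avg n g| <= B * k%:R / 3 ^+ n.
Proof.
move=> B0 hg; rewrite /avg -mulrBr -sumrB normrM gtr0_norm; last first.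
  by rewrite invr_gt0 expr3_gt0.
rewrite mulrC ler_pM2r ?invr_gt0 ?expr3_gt0//.
have B_ge0 : 0 <= B by rewrite (le_trans _ (B0 0%N)).
rewrite (le_trans (ler_norm_sum _ _ _))//.
have [kn|kn] := leqP k (3 ^ n); last first.
  apply: le_trans (_ : \sum_(0 <= i < (3 ^ n)%N) B <= _); first exact: ler_sum.
  rewrite sumr_const_nat subn0 -[B *+ _]mulr_natr ler_wpM2l// ler_nat ltnW//.
rewrite (@big_cat_nat _ _ _ (3 ^ n - k))//= ?leq_subr// big_nat big1 ?add0r.
  apply: le_trans (_ : \sum_(3 ^ n - k <= i < (3 ^ n)%N) B <= _); first exact: ler_sum.
  by rewrite sumr_const_nat subKn// mulr_natr.
by move=> i i_lt; rewrite hg ?subrr ?normr0//; lia.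
Qed.

Lemma avg_shift n t h B : (forall i, `|h i| <= B) ->
  `|avg n (fun i => h (i + t)%N) - avg n h| <= 2 * B * t%:R / 3 ^+ n.
Proof.
move=> hB; rewrite /avg -mulrBr normrM gtr0_norm ?invr_gt0 ?expr3_gt0//.
rewrite mulrC ler_pM2r ?invr_gt0 ?expr3_gt0//.
elim: t => [|t IH].
  by under eq_bigr do rewrite addn0; rewrite subrr normr0 mulr0.
have shiftE : h t + \sum_(0 <= i < (3 ^ n)%N) h (i + t.+1)%N =
    \sum_(0 <= i < (3 ^ n)%N) h (i + t)%N + h ((3 ^ n)%N + t)%N.
  rewrite -(big_nat_recr _ _ (fun i => h (i + t)%N))//=.
  by rewrite big_nat_recl//=; under eq_bigr do rewrite addnS -addSn.
have := hB t; have := hB (3 ^ n + t)%N.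
move: IH shiftE; move: (\sum_(_ <= i < _) _) (\sum_(_ <= i < _) _) => S1 S2.
move: (\sum_(_ <= i < _) _) (h t) (h _) => S3 x y.
rewrite -[t.+1%:R]natr1 => IH shiftE hy hx.
move: IH hx hy; rewrite !ler_norml => /andP[? ?] /andP[? ?] /andP[? ?].
by apply/andP; split; nra.
Qed.

Lemma avg_le_dist n h g e : (forall i, `|h i - g i| <= e) ->
  `|avg n h - avg n g| <= e.
Proof.
move=> hg; rewrite ler_norml -{1}(avg_cst n (- e)) -{2}(avg_cst n e).
have -> : avg n h - avg n g = avg n (fun i => h i - g i).
  by rewrite /avg sumrB mulrBr.
by apply/andP; split; apply: ler_avg => i; have := hg i; rewrite ler_norml => /andP[].
Qed.

Lemma avg1E h : avg 1 h = 3^-1 * (h 0%N + h 1%N + h 2%N).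
Proof. by rewrite /avg expr1 expn1 !big_nat_recr//= big_geq// add0r. Qed.

Lemma geometric_limit (x : nat -> R) D :
  (forall n, `|x n.+1 - x n| <= D / 3 ^+ n) ->
  exists l, forall n, `|x n - l| <= 3 / 2 * (D / 3 ^+ n).
Proof.
(* The factor [3 / 2] sums the geometric series of the steps still to come, so [x n + e n]
   decreases, [x n - e n] increases, and the limit is caught between them. *)
move=> xD; pose e n := 3 / 2 * (D / 3 ^+ n).
have eS n : e n = e n.+1 + D / 3 ^+ n.
  rewrite /e exprS; field; rewrite gt_eqF// expr3_gt0.
have e_ge0 n : 0 <= e n.
  apply: mulr_ge0; first by rewrite divr_ge0.
  exact: le_trans (normr_ge0 _) (xD n).
have dec : {homo (fun n => x n + e n) : m n / (m <= n)%N >-> n <= m}.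
  apply: homo_leq; [by move=> ?; exact: lexx| by move=> y z t /[swap]; exact: le_trans|].
  by move=> n; have := xD n; rewrite ler_norml (eS n) => /andP[_ ?]; lra.
have inc : {homo (fun n => x n - e n) : m n / (m <= n)%N >-> m <= n}.
  apply: homo_leq; [by move=> ?; exact: lexx| by move=> y z t; exact: le_trans|].
  by move=> n; have := xD n; rewrite ler_norml (eS n) => /andP[? _]; lra.
have below m n : x m - e m <= x n + e n.
  apply: le_trans (inc m (maxn m n) (leq_maxl _ _)) _.
  apply: le_trans (dec n (maxn m n) (leq_maxr _ _)).
  by have := e_ge0 (maxn m n); lra.
pose A : set R := range (fun n => x n - e n).
have A0 : A !=set0 by exists (x 0%N - e 0%N), 0%N.
exists (sup A) => n; rewrite ler_norml; apply/andP; split.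
  rewrite -/(e n) lerBrDl lerBlDr; apply: ge_sup => // _ [m _ <-].
  exact: below.
rewrite -/(e n) lerBlDl -lerBlDr; apply: ub_le_sup; last by exists n.
by exists (x 0%N + e 0%N) => _ [m _ <-]; exact: below.
Qed.

(** Two letters are kept because the blocks of a single fixed point at [q] and [q + k] start from
    different letters in general. *)
Definition coincidence k n a b : R :=
  avg n (fun i => (fixpt a (i + k) == fixpt b i)%:R).

Lemma block_coincidence k n q q' a b :
  `|avg n (fun r => (fixpt a (3 ^ n * q + r + k) == fixpt b (3 ^ n * q' + r))%:R)
    - coincidence k n (fixpt a q) (fixpt b q')| <= k%:R / 3 ^+ n.
Proof.
rewrite -[k%:R]mul1r; apply: avg_close => i.
  by do 2! case: (_ == _); rewrite ?subrr ?normr0 ?subr0 ?sub0r ?normrN ?normr1.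
by move=> ik; rewrite -addnA !fixpt_block//; lia.
Qed.

(** A block of level [n + 1] is three blocks of level [n], and column [t] moves the pair [a], [b] to
    [col t a], [col t b]. Only the positions whose partner falls into the next block spoil the
    recursion. *)
Lemma coincidence_step k n a b :
  `|coincidence k n.+1 a b - 3^-1 * (coincidence k n (col 0 a) (col 0 b) +
      coincidence k n (col 1 a) (col 1 b) + coincidence k n (col 2 a) (col 2 b))|
  <= k%:R / 3 ^+ n.
Proof.
rewrite {1}/coincidence -addn1 avg_blocks'.
rewrite -!fixpt_col// -(avg1E (fun q => coincidence k n (fixpt a q) (fixpt b q))).
by apply: avg_le_dist => q; exact: block_coincidence.
Qed.

(** At every position the three fixed points show the three letters in some order, so a given letter
    matches exactly one of them. *)
Lemma coincidence_total k n a :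
  coincidence k n a 0 + coincidence k n a 1 + coincidence k n a 2 = 1.
Proof.
rewrite -!avgD -[RHS](avg_cst n 1); apply: eq_avg => i.
have [b ->] : exists b, fixpt a (i + k) = fixpt b i.
  have /codomP[b ->] : fixpt a (i + k) \in codom (fixpt ^~ i).
    have inj : injective (fixpt ^~ i).
      by move=> b c /eqP; rewrite fixpt_eq => /eqP.
    by rewrite (inj_card_onto inj).
  by exists b.
by rewrite !fixpt_eq; move: b; apply: letter_cases; rewrite /= !(addr0, add0r).
Qed.

Lemma coincidence_ge0 k n a b : 0 <= coincidence k n a b.
Proof.
by rewrite -(avg_cst n 0); apply: ler_avg => i; rewrite ler0n.
Qed.

(* Products of two columns exhaust the symmetric group, so two steps of the
   averaging contain the mean over the orbit with weight 6/9: only 3/9 of the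
   deviation survives. *)
Lemma diag_contraction (x y z x' y' z' x'' y'' z'' d e e' : R) :
  let m := (x + y + z) / 3 in let m'' := (x'' + y'' + z'') / 3 in
  `|x' - 3^-1 * (x + x + y)| <= e -> `|y' - 3^-1 * (y + z + z)| <= e ->
  `|z' - 3^-1 * (z + y + x)| <= e ->
  `|x'' - 3^-1 * (x' + x' + y')| <= e' -> `|y'' - 3^-1 * (y' + z' + z')| <= e' ->
  `|z'' - 3^-1 * (z' + y' + x')| <= e' ->
  `|x - m| <= d -> `|y - m| <= d -> `|z - m| <= d ->
  [/\ `|x'' - m''| <= d / 3 + 2 * (e + e'), `|y'' - m''| <= d / 3 + 2 * (e + e')
    & `|z'' - m''| <= d / 3 + 2 * (e + e')].
Proof.
rewrite /= !ler_norml.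
do 9! (move=> /andP[? ?]).
by split; apply/andP; split; lra.
Qed.

(* x1, ..., x6 are indexed by the pairs 01, 02, 10, 12, 20, 21. *)
Lemma offdiag_contraction (x1 x2 x3 x4 x5 x6 y1 y2 y3 y4 y5 y6
    z1 z2 z3 z4 z5 z6 d e e' : R) :
  let m := (x1 + x2 + x3 + x4 + x5 + x6) / 6 in
  let m'' := (z1 + z2 + z3 + z4 + z5 + z6) / 6 in
  [/\ `|y1 - 3^-1 * (x1 + x2 + x4)| <= e, `|y2 - 3^-1 * (x2 + x1 + x3)| <= e
    & `|y3 - 3^-1 * (x3 + x5 + x6)| <= e] ->
  [/\ `|y4 - 3^-1 * (x4 + x6 + x5)| <= e, `|y5 - 3^-1 * (x5 + x3 + x1)| <= e
    & `|y6 - 3^-1 * (x6 + x4 + x2)| <= e] ->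
  [/\ `|z1 - 3^-1 * (y1 + y2 + y4)| <= e', `|z2 - 3^-1 * (y2 + y1 + y3)| <= e'
    & `|z3 - 3^-1 * (y3 + y5 + y6)| <= e'] ->
  [/\ `|z4 - 3^-1 * (y4 + y6 + y5)| <= e', `|z5 - 3^-1 * (y5 + y3 + y1)| <= e'
    & `|z6 - 3^-1 * (y6 + y4 + y2)| <= e'] ->
  [/\ `|x1 - m| <= d, `|x2 - m| <= d & `|x3 - m| <= d] ->
  [/\ `|x4 - m| <= d, `|x5 - m| <= d & `|x6 - m| <= d] ->
  [/\ `|z1 - m''| <= d / 3 + 2 * (e + e'), `|z2 - m''| <= d / 3 + 2 * (e + e')
    & `|z3 - m''| <= d / 3 + 2 * (e + e')] /\
  [/\ `|z4 - m''| <= d / 3 + 2 * (e + e'), `|z5 - m''| <= d / 3 + 2 * (e + e')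
    & `|z6 - m''| <= d / 3 + 2 * (e + e')].
Proof.
rewrite /= !ler_norml.
do 6! (case; do 3! (move=> /andP[? ?])).
by split; split; apply/andP; split; lra.
Qed.

End Average.

(** * Limits of the coincidence frequencies *)

Section Mixing.
Variable R : realType.
Implicit Types (k n m : nat) (a b : letter).

Let G := @coincidence R.

Definition diag_mean k n : R := (G k n 0 0 + G k n 1 1 + G k n 2 2) / 3.

Definition offdiag_mean k n : R :=
  (G k n 0 1 + G k n 0 2 + G k n 1 0 + G k n 1 2 + G k n 2 0 + G k n 2 1) / 6.

Lemma offdiag_meanE k n : offdiag_mean k n = (1 - diag_mean k n) / 2.
Proof.
have := coincidence_total R k n 0; have := coincidence_total R k n 1.
have := coincidence_total R k n 2; rewrite /offdiag_mean /diag_mean /G.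
lra.
Qed.

Let coincidence_near_mean_dist k n d := forall a b,
  `|G k n a b - (if a == b then diag_mean k n else offdiag_mean k n)| <= d.

Lemma coincidence_near_mean_step k n d : coincidence_near_mean_dist k n d ->
  coincidence_near_mean_dist k n.+2
    (d / 3 + 2 * (k%:R / 3 ^+ n + k%:R / 3 ^+ n.+1)).
Proof.
move=> near_n; pose S i a b := coincidence_step R k i a b.
have [D1 D2 D3] := @diag_contraction R (G k n 0 0) (G k n 1 1) (G k n 2 2)
  (G k n.+1 0 0) (G k n.+1 1 1) (G k n.+1 2 2)
  (G k n.+2 0 0) (G k n.+2 1 1) (G k n.+2 2 2)
  d (k%:R / 3 ^+ n) (k%:R / 3 ^+ n.+1) (S n 0 0) (S n 1 1) (S n 2 2)
  (S n.+1 0 0) (S n.+1 1 1) (S n.+1 2 2) (near_n 0 0) (near_n 1 1) (near_n 2 2).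
have [[E1 E2 E3] [E4 E5 E6]] := @offdiag_contraction R
  (G k n 0 1) (G k n 0 2) (G k n 1 0) (G k n 1 2) (G k n 2 0) (G k n 2 1)
  (G k n.+1 0 1) (G k n.+1 0 2) (G k n.+1 1 0)
  (G k n.+1 1 2) (G k n.+1 2 0) (G k n.+1 2 1)
  (G k n.+2 0 1) (G k n.+2 0 2) (G k n.+2 1 0)
  (G k n.+2 1 2) (G k n.+2 2 0) (G k n.+2 2 1)
  d (k%:R / 3 ^+ n) (k%:R / 3 ^+ n.+1)
  (And3 (S n 0 1) (S n 0 2) (S n 1 0)) (And3 (S n 1 2) (S n 2 0) (S n 2 1))
  (And3 (S n.+1 0 1) (S n.+1 0 2) (S n.+1 1 0))
  (And3 (S n.+1 1 2) (S n.+1 2 0) (S n.+1 2 1))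
  (And3 (near_n 0 1) (near_n 0 2) (near_n 1 0))
  (And3 (near_n 1 2) (near_n 2 0) (near_n 2 1)).
by apply: letter_cases; apply: letter_cases.
Qed.

Lemma coincidence_le1 k n a b : G k n a b <= 1.
Proof.
rewrite -(avg_cst n (1 : R)); apply: ler_avg => i.
by case: (_ == _).
Qed.

Lemma expr23_ge0 n : 0 <= (2 / 3) ^+ n :> R.
Proof. by rewrite exprn_ge0// divr_ge0. Qed.

Lemma expr3V_le n : (3 ^+ n)^-1 <= (2 / 3) ^+ n :> R.
Proof.
by rewrite expr_div_n ler_peMl// exprn_ege1// ler1n.
Qed.

(** The contraction by $1/3$ takes two steps, so the induction carries two consecutive levels. The
    rate $2/3$ leaves room, since $4/9 > 1/3$: with constant $C$ the surplus $C/9$ has to absorb the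
    error $2(k/3^n + k/3^{n+1}) = \frac83 k/3^n$, whence [24 * k]. The summand [2] makes the bound
    trivial at levels 0 and 1. *)
Lemma coincidence_near_mean k n :
  coincidence_near_mean_dist k n ((24 * k%:R + 2) * (2 / 3) ^+ n).
Proof.
pose C : R := 24 * k%:R + 2.
have k0 : 0 <= k%:R :> R by exact: ler0n.
have trivial_bound i a b :
    `|G k i a b - (if a == b then diag_mean k i else offdiag_mean k i)| <= 1.
  have g0 c c' : 0 <= G k i c c' <= 1.
    by rewrite coincidence_ge0 coincidence_le1.
  rewrite ler_norml.
  have := g0 a b; rewrite offdiag_meanE /diag_mean.
  move: (g0 0 0) (g0 1 1) (g0 2 2).
  by case: (a == b) => /andP[? ?] /andP[? ?] /andP[? ?] /andP[? ?];
    apply/andP; split; lra.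
suff [] : coincidence_near_mean_dist k n (C * (2 / 3) ^+ n) /\
  coincidence_near_mean_dist k n.+1 (C * (2 / 3) ^+ n.+1) by [].
elim: n => [|n [IH1 IH2]].
  by split=> a b; apply: le_trans (trivial_bound _ a b) _;
    rewrite ?expr0 ?expr1 /C; lra.
split=> // a b; apply: le_trans (coincidence_near_mean_step IH1 a b) _.
have e3 : 0 < 3 ^+ n :> R by exact: expr3_gt0.
have := expr3V_le n; have := expr23_ge0 n; rewrite !exprS.
have -> : (3 * 3 ^+ n)^-1 = 3^-1 * (3 ^+ n)^-1 :> R by rewrite invfM.
have : 0 <= (3 ^+ n)^-1 :> R by rewrite invr_ge0 ltW.
move: ((2 / 3) ^+ n) ((3 ^+ n)^-1) => y x; rewrite /C => x0 y0 xy.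
have : k%:R * x <= k%:R * y by rewrite ler_wpM2l.
nra.
Qed.

(** Every column permutes the letters, so the exact recursion preserves the mean over the diagonal
    and only the boundary error remains. *)
Lemma diag_mean_step k n : `|diag_mean k n.+1 - diag_mean k n| <= k%:R / 3 ^+ n.
Proof.
have S a b := coincidence_step R k n a b.
have : `|G k n.+1 0 0 - 3^-1 * (G k n 0 0 + G k n 0 0 + G k n 1 1)| <=
  k%:R / 3 ^+ n by exact: (S 0 0).
have : `|G k n.+1 1 1 - 3^-1 * (G k n 1 1 + G k n 2 2 + G k n 2 2)| <=
  k%:R / 3 ^+ n by exact: (S 1 1).
have : `|G k n.+1 2 2 - 3^-1 * (G k n 2 2 + G k n 1 1 + G k n 0 0)| <=
  k%:R / 3 ^+ n by exact: (S 2 2).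
rewrite /diag_mean !ler_norml => /andP[? ?] /andP[? ?] /andP[? ?].
by apply/andP; split; lra.
Qed.

Lemma coincidence_limit k : exists alpha C : R, 0 <= C /\
  [/\ forall n a b, `|coincidence R k n a b - (if a == b then alpha else (1 - alpha) / 2)|
        <= C * (2 / 3) ^+ n
    & forall n, `|diag_mean k n - alpha| <= 3 / 2 * (k%:R / 3 ^+ n)].
Proof.
have [alpha alphaP] := geometric_limit (diag_mean_step k).
(* The [24] of [coincidence_near_mean] plus the [3 / 2] from the convergence of the mean, rounded
   up. *)
exists alpha, (26 * k%:R + 2); split; first by rewrite addr_ge0// mulr_ge0.
split=> // n a b; have := coincidence_near_mean k n a b.
have := alphaP n; rewrite offdiag_meanE -/G.
have : k%:R / 3 ^+ n <= k%:R * (2 / 3) ^+ n :> R.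
  by rewrite ler_wpM2l// expr3V_le.
have : 0 <= k%:R / 3 ^+ n :> R by rewrite divr_ge0// ltW// expr3_gt0.
rewrite !ler_norml; move: (k%:R / _) => x x0 xk.
by case: (a == b) => /andP[? ?] /andP[? ?]; apply/andP; split; lra.
Qed.

End Mixing.

(** * Upper limits of real sequences *)

Section Limsup.
Variable R : realType.
Implicit Types (x y : nat -> R) (b c : R).

(** Bounds the upper limit without forming it, so that all values stay in [R] and no average has to
    converge. *)
Definition limsup_le x b := forall e, 0 < e -> \forall n \near \oo, x n <= b + e.

Lemma limsup_leD x y b c :
  limsup_le x b -> limsup_le y c -> limsup_le (fun n => x n + y n) (b + c).
Proof.
move=> xb yc e e0; have e20 : 0 < e / 2 by rewrite divr_gt0.
near=> n; have xn : x n <= b + e / 2 by near: n; exact: xb.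
have yn : y n <= c + e / 2 by near: n; exact: yc.
lra.
Unshelve. all: by end_near. Qed.

Lemma limsup_leZ x b c : 0 <= c -> limsup_le x b -> limsup_le (fun n => c * x n) (c * b).
Proof.
move=> c0 xb e e0; have e20 : 0 < e / (c + 1) by rewrite divr_gt0// ltr_wpDl.
near=> n; have xn : x n <= b + e / (c + 1) by near: n; exact: xb.
have := ler_wpM2l c0 xn; rewrite mulrDr => /le_trans; apply; rewrite lerD2l.
by rewrite mulrA ler_pdivrMr ?ltr_wpDl// mulrDr mulr1 mulrC lerDl ltW.
Unshelve. all: by end_near. Qed.

Lemma eq_limsup_le x y b : x =1 y -> limsup_le x b -> limsup_le y b.
Proof. by move=> /funext ->. Qed.

Lemma limsup_le_cst b : limsup_le (fun=> b) b.
Proof. by move=> e e0; near=> n; rewrite lerDl ltW. Unshelve. all: by end_near. Qed.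

Lemma limsup_le_sum (I : Type) (s : seq I) (F : I -> nat -> R) (B : I -> R) :
  (forall i, limsup_le (F i) (B i)) ->
  limsup_le (fun n => \sum_(i <- s) F i n) (\sum_(i <- s) B i).
Proof.
move=> FB; elim: s => [|i s IH].
  rewrite big_nil; apply: eq_limsup_le (limsup_le_cst 0) => n.
  by rewrite big_nil.
rewrite big_cons; apply: eq_limsup_le (limsup_leD (FB i) IH) => n.
by rewrite big_cons.
Qed.

Lemma limsup_le_trans x y b c : limsup_le y b ->
  (\forall n \near \oo, x n <= y n) -> b <= c -> limsup_le x c.
Proof.
move=> yb xy bc e e0; near=> n; apply: (@le_trans _ _ (y n)).
  by near: n.
apply: (@le_trans _ _ (b + e)); last by rewrite lerD2r.
by near: n; exact: yb.
Unshelve. all: by end_near. Qed.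

Lemma limsup_le_shift d x b : limsup_le (fun n => x (d + n)%N) b -> limsup_le x b.
Proof.
move=> xb e /xb [M _ MP]; exists (d + M)%N => // n /= dMn.
by have /= := MP (n - d)%N; rewrite subnKC; [apply; lia|lia].
Qed.

Lemma cvg_limsup_le x b : x @ \oo --> b -> limsup_le x b.
Proof.
move=> /cvgrPdist_le xb e e0; near=> n.
have : `|b - x n| <= e by near: n; exact: xb.
by rewrite ler_norml => /andP[? ?]; lra.
Unshelve. all: by end_near. Qed.

Lemma geometric_cvg0 (K : R) : (fun n => K * (2 / 3) ^+ n) @ \oo --> (0 : R).
Proof.
rewrite -(mulr0 K); apply: cvgM; first exact: cvg_cst.
by apply: cvg_expr; rewrite ger0_norm ?divr_ge0// ltr_pdivrMr//; lra.
Qed.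

Lemma limsup_le_geometric d x b K :
  (forall n, x (d + n)%N <= b + K * (2 / 3) ^+ n) -> limsup_le x b.
Proof.
move=> xb; apply: (@limsup_le_shift d).
apply: (@limsup_le_trans _ (fun n => b + K * (2 / 3) ^+ n) (b + 0)).
- exact: limsup_leD (limsup_le_cst b) (cvg_limsup_le (geometric_cvg0 K)).
- by near=> n.
- by rewrite addr0.
Unshelve. all: by end_near. Qed.

End Limsup.

(** * Correlations at two distances *)

Section SecondMoment.
Variable R : realType.
Implicit Types (k n m q : nat) (a b : letter).

Definition correlation a x y n : R :=
  avg n (fun j => (fixpt a (j + x) == fixpt a (j + y))%:R).

Lemma correlationC a x y n : correlation a x y n = correlation a y x n.
Proof. by apply: eq_avg => j; rewrite eq_sym. Qed.

Lemma correlationxx a x n : correlation a x x n = 1.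
Proof. by rewrite -[RHS](avg_cst n 1); apply: eq_avg => j; rewrite eqxx. Qed.

(** The positions [3 * (q + x) + r] and [3 * (q + y) + r] have the same last digit, so one injective
    column is applied to both letters. Unlike the recursion on coincidences, this is exact. *)
Lemma correlation_scale p a x y n :
  correlation a (3 ^ p * x) (3 ^ p * y) (p + n) = correlation a x y n.
Proof.
elim: p => [|p IH]; first by rewrite !mul1n.
rewrite -{}IH; have -> : (p.+1 + n = 1 + (p + n))%N by [].
rewrite /correlation avg_blocks.
rewrite -[RHS](avg_cst 1) !avg1E.
suff E r : (r < 3)%N -> avg (p + n) (fun q =>
    (fixpt a (3 ^ 1 * q + r + 3 ^ p.+1 * x) == fixpt a (3 ^ 1 * q + r + 3 ^ p.+1 * y))%:R)
  = avg (p + n) (fun j => (fixpt a (j + 3 ^ p * x) == fixpt a (j + 3 ^ p * y))%:R) :> R.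
  by rewrite !E.
move=> r3; apply: eq_avg => q.
have E z : (3 ^ 1 * q + r + 3 ^ p.+1 * z = 3 * (q + 3 ^ p * z) + r)%N.
  by rewrite expn1 expnS -mulnA; lia.
by rewrite !E !fixpt_rec// col_inj.
Qed.

Lemma coincidence_correlation k n a : coincidence R k n a a = correlation a 0 k n.
Proof. by rewrite correlationC; apply: eq_avg => i; rewrite addn0. Qed.

Section FixedDistance.
Variables (k : nat) (alpha C : R).
Hypothesis C_ge0 : 0 <= C.
Hypothesis alphaP : forall n a b,
  `|coincidence R k n a b - (if a == b then alpha else (1 - alpha) / 2)|
  <= C * (2 / 3) ^+ n.

Let beta := (1 - alpha) / 2.
(** Equals $\alpha^2 + (1-\alpha)^2/2$; in this form it is the average of $\beta +
    (\alpha-\beta)\chi$ for an indicator $\chi$ of frequency $\alpha$. *)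
Let gamma := beta + (alpha - beta) * alpha.
Let D := C + k%:R + C * `|alpha - beta|.

Lemma mixing_const_ge0 : 0 <= D.
Proof. by rewrite !addr_ge0// mulr_ge0. Qed.

(** [step1] cuts the average into blocks, [step2] replaces the coincidence of two blocks by its
    limit, which sees only whether their letters are equal, and [step3] averages this over pairs of
    blocks at distance [k]. The three errors, with constants [k], [C] and [C] times
    $|\alpha-\beta|$, make up [D]. *)
Lemma correlation_mixing a n m :
  `|correlation a k (3 ^ n * k) (n + m) - gamma| <=
  D * (2 / 3) ^+ n + D * (2 / 3) ^+ m.
Proof.
pose g q := coincidence R k n (fixpt a q) (fixpt a (q + k)).
have step1 : `|correlation a k (3 ^ n * k) (n + m) - avg m g| <= k%:R / 3 ^+ n.
  rewrite /correlation avg_blocks'; apply: avg_le_dist => q.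
  have -> : (fun r => (fixpt a (3 ^ n * q + r + k) ==
      fixpt a (3 ^ n * q + r + 3 ^ n * k))%:R) =
    (fun r => (fixpt a (3 ^ n * q + r + k) == fixpt a (3 ^ n * (q + k) + r))%:R) :> (nat -> R).
    by apply/funext => r; congr ((_ == fixpt a _)%:R); rewrite mulnDr addnAC.
  exact: block_coincidence.
pose g' q := beta + (alpha - beta) * (fixpt a (q + 0) == fixpt a (q + k))%:R.
have step2 : `|avg m g - avg m g'| <= C * (2 / 3) ^+ n.
  apply: avg_le_dist => q; have := alphaP n (fixpt a q) (fixpt a (q + k)).
  rewrite /g /g' addn0; case: (_ == _) => /=; last by rewrite mulr0 addr0.
  by rewrite mulr1 [beta + _]addrC subrK.
have step3 : `|avg m g' - gamma| <= C * `|alpha - beta| * (2 / 3) ^+ m.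
  rewrite avgD avg_cst avgZ -/(correlation a 0 k m) -coincidence_correlation.
  rewrite /gamma opprD addrACA subrr add0r -mulrBr normrM mulrC mulrAC.
  by rewrite ler_wpM2r//; have := alphaP m a a; rewrite eqxx.
rewrite -[_ - gamma](subrKA (avg m g)) -[avg m g - gamma](subrKA (avg m g')).
rewrite (le_trans (ler_normD _ _))//.
have := ler_normD (avg m g - avg m g') (avg m g' - gamma).
have : k%:R / 3 ^+ n <= k%:R * (2 / 3) ^+ n :> R by rewrite ler_wpM2l// expr3V_le.
have := @expr23_ge0 R n; have := @expr23_ge0 R m; rewrite /D.
have Cab : 0 <= C * `|alpha - beta| by rewrite mulr_ge0.
have k0 : 0 <= k%:R :> R by [].
move: ((2 / 3) ^+ n) ((2 / 3) ^+ m) (C * `|_|) step3 step2 step1 Cab => y z w.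
move=> ? ? ? w0 z0 y0 ? ?.
have := mulr_ge0 k0 z0; have := mulr_ge0 C_ge0 z0; have := mulr_ge0 w0 y0.
lra.
Qed.

End FixedDistance.
End SecondMoment.

(** * Annihilation of functions of finitely many letters *)

Section TrigPoly.
Variable R : realType.
Implicit Types (l : seq (R * nat)) (h : nat -> R).

(* A list of pairs (w, k) stands for the polynomial \sum w z^k: z is the shift
   on nat-indexed sequences here, the shift on the subshift in shift_op, and a
   complex number in trig_eval. *)
Definition nat_op l h (q : nat) : R := \sum_(p <- l) p.1 * h (q + p.2)%N.

Definition weight l : R := \sum_(p <- l) `|p.1|.

Definition trig_mul l1 l2 : seq (R * nat) :=
  [seq (p.1 * p'.1, (p.2 + p'.2)%N) | p <- l1, p' <- l2].

Definition trig_dilate d l : seq (R * nat) := [seq (p.1, (d * p.2)%N) | p <- l].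

Definition trig_sub l b : seq (R * nat) := (- b, 0%N) :: l.

(** The spacing [s] puts any two exponents at scales at least $3^s$ apart, where correlations are
    nearly independent of the pair; [N] dilutes the terms in which a shift meets itself. *)
Definition trig_mean k s N : seq (R * nat) :=
  [seq (N.+1%:R^-1, (k * 3 ^ (s * m))%N) | m <- iota 0 N.+1].

Lemma nat_op_mul l1 l2 h : nat_op (trig_mul l1 l2) h =1 nat_op l1 (nat_op l2 h).
Proof.
move=> q; rewrite /nat_op /trig_mul big_allpairs_dep; apply: eq_bigr => p _.
by rewrite mulr_sumr; apply: eq_bigr => p' _; rewrite /= mulrA addnA.
Qed.

Lemma weight_ge0 l : 0 <= weight l.
Proof. exact: sumr_ge0. Qed.

Lemma weight_mul l1 l2 : weight (trig_mul l1 l2) = weight l1 * weight l2.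
Proof.
rewrite /weight /trig_mul big_allpairs_dep mulr_suml; apply: eq_bigr => p _.
by rewrite mulr_sumr; apply: eq_bigr => p' _; rewrite normrM.
Qed.

Lemma weight_dilate d l : weight (trig_dilate d l) = weight l.
Proof. by rewrite /weight big_map. Qed.

Lemma weight_sub l b : weight (trig_sub l b) = `|b| + weight l.
Proof. by rewrite /weight big_cons normrN. Qed.

Lemma weight_mean k s N : weight (trig_mean k s N) = 1.
Proof.
rewrite /weight big_map (eq_bigr (fun=> N.+1%:R^-1)) => [|i _]; last first.
  by rewrite /= ger0_norm// invr_ge0.
by rewrite big_const_seq count_predT size_iota iter_addr addr0 -[_ *+ _]mulr_natr mulVf.
Qed.

Lemma sum_mean k s N : \sum_(p <- trig_mean k s N) p.1 = 1.
Proof.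
rewrite -(weight_mean k s N); apply: eq_big_seq => p /mapP[m _ ->] /=.
by rewrite ger0_norm// invr_ge0.
Qed.

(** The squares stay under the weighted sum, so that averaging or integrating this pointwise bound
    yields an operator bound by [weight]. *)
Lemma cauchy_schwarz_weight (I : Type) (s : seq I) (w x : I -> R) :
  (\sum_(i <- s) w i * x i) ^+ 2 <=
  (\sum_(i <- s) `|w i|) * \sum_(i <- s) `|w i| * x i ^+ 2.
Proof.
elim: s => [|i s IH]; first by rewrite !big_nil expr0n mulr0.
rewrite !big_cons; move: IH.
have : 0 <= \sum_(j <- s) `|w j| by exact: sumr_ge0.
have : 0 <= \sum_(j <- s) `|w j| * x j ^+ 2.
  by apply: sumr_ge0 => j _; rewrite mulr_ge0// sqr_ge0.
move: (\sum_(j <- s) w j * x j) (\sum_(j <- s) `|w j|) => S W.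
move: (\sum_(j <- s) _) (x i) => T y T0 W0 STW.
have cross : `|2 * y * S| <= W * y ^+ 2 + T.
  have WyT : 0 <= W * y ^+ 2 + T by rewrite addr_ge0// mulr_ge0 ?sqr_ge0.
  rewrite -ler_sqr ?nnegrE//.
  rewrite -normrX ger0_norm ?sqr_ge0// !exprMn.
  have := ler_wpM2l (sqr_ge0 y) STW; have := sqr_ge0 (W * y ^+ 2 - T); nra.
have : w i * (2 * y * S) <= `|w i| * (W * y ^+ 2 + T).
  apply: le_trans (ler_norm _) _; rewrite normrM.
  exact: ler_wpM2l.
have : (w i) ^+ 2 = `|w i| ^+ 2 by rewrite real_normK// num_real.
nra.
Qed.

Lemma nat_op_sqr l h q :
  nat_op l h q ^+ 2 <= weight l * \sum_(p <- l) `|p.1| * h (q + p.2)%N ^+ 2.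
Proof. exact: cauchy_schwarz_weight. Qed.

Lemma nat_op_bounded l h B : (forall q, `|h q| <= B) ->
  forall q, `|nat_op l h q| <= weight l * B.
Proof.
move=> hB q; rewrite (le_trans (ler_norm_sum _ _ _))// mulr_suml.
by apply: ler_sum => p _; rewrite normrM ler_wpM2l.
Qed.

Lemma avg_sqr_shift_limsup h t B b : (forall i, `|h i| <= B) ->
  limsup_le (fun n => avg n h) b -> limsup_le (fun n => avg n (fun i => h (i + t)%N)) b.
Proof.
move=> hB hb.
apply: (@limsup_le_trans _ _ (fun n => avg n h + 2 * B * t%:R * (2 / 3) ^+ n)
  (b + 0)); last by rewrite addr0.
  exact: limsup_leD hb (cvg_limsup_le (geometric_cvg0 _)).
near=> n; have := avg_shift n t hB; rewrite ler_norml => /andP[_].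
rewrite lerBlDl => /le_trans; apply; rewrite lerD2l ler_wpM2l ?expr3V_le//.
by rewrite !mulr_ge0// (le_trans (normr_ge0 _) (hB 0%N)).
Unshelve. all: by end_near. Qed.

End TrigPoly.

(** * The second moment of $V - c$ on centered letters *)

Section SecondMomentBound.
Variable R : realType.
Implicit Types (a b : letter).

Definition centered b a : R := (a == b)%:R - 3^-1.

Lemma sum_letters (F : letter -> R) : \sum_b F b = F 0 + F 1 + F 2.
Proof.
rewrite !big_ord_recr big_ord0 /= add0r; congr (F _ + F _ + F _);
exact/val_inj.
Qed.

(** The three centered indicators form a tight frame of the mean-zero functions, so their kernel
    only sees whether two letters are equal. This turns sums of squares into coincidence
    frequencies. *)
Lemma sum_centered a b :
  \sum_c centered c a * centered c b = (a == b)%:R - 3^-1.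
Proof.
rewrite sum_letters /centered; move: a b.
by apply: letter_cases; apply: letter_cases; rewrite /=; field.
Qed.

Lemma centered_decomposition (F : letter -> R) a :
  F a = 3^-1 * (F 0 + F 1 + F 2) + \sum_b F b * centered b a.
Proof.
rewrite sum_letters /centered; move: a.
by apply: letter_cases; rewrite /=; field.
Qed.

Lemma sum_nat_op_centered l a q :
  \sum_b nat_op l (fun i => centered b (fixpt a i)) q ^+ 2 =
  \sum_(p <- l) \sum_(p' <- l) p.1 * p'.1 *
    ((fixpt a (q + p.2) == fixpt a (q + p'.2))%:R - 3^-1).
Proof.
under eq_bigr do rewrite expr2 mulr_suml.
rewrite exchange_big; apply: eq_bigr => p _.
under eq_bigr do rewrite mulr_sumr.
rewrite exchange_big; apply: eq_bigr => p' _ /=.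
rewrite -sum_centered mulr_sumr; apply: eq_bigr => c _.
by rewrite mulrACA.
Qed.

Lemma avg_sum_nat_op_centered l a n :
  avg n (fun q => \sum_b nat_op l (fun i => centered b (fixpt a i)) q ^+ 2) =
  \sum_(p <- l) \sum_(p' <- l) p.1 * p'.1 * (correlation R a p.2 p'.2 n - 3^-1).
Proof.
under eq_avg do rewrite sum_nat_op_centered.
rewrite avg_sum; apply: eq_bigr => p _.
rewrite avg_sum; apply: eq_bigr => p' _.
by rewrite avgZ -{2}(avg_cst n (3^-1 : R)) /avg -mulrBr -sumrB.
Qed.

Section FixedDistance.
Variables (k : nat) (alpha C : R).
Hypothesis C_ge0 : 0 <= C.
Hypothesis alphaP : forall n a b,
  `|coincidence R k n a b - (if a == b then alpha else (1 - alpha) / 2)|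
  <= C * (2 / 3) ^+ n.

Let A := alpha - 3^-1.
(** Minimizes $\frac23c^2 - 2cA$, the part of the second moment of $V - c$ that depends on $c$; the
    minimum is $-\frac32A^2$. *)
Let c := 3 / 2 * A.
Let D := C + k%:R + C * `|alpha - (1 - alpha) / 2|.

(** The scalar [z] may be negative, as in the cross terms of the square, so the estimate behind this
    bound is two-sided. *)
Lemma correlation_scaled_limsup a z m s :
  limsup_le (fun n => z * (correlation R a 0 (k * 3 ^ (s * m)) n - 3^-1)) (z * A).
Proof.
apply: (@limsup_le_geometric _ (s * m) _ _ (`|z| * C)) => n.
have -> : correlation R a 0 (k * 3 ^ (s * m)) (s * m + n) = correlation R a 0 k n.
  by rewrite -(correlation_scale R (s * m) a 0 k n) muln0 mulnC.
rewrite -coincidence_correlation -mulrA -lerBlDl -mulrBr.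
rewrite (le_trans (ler_norm _))// normrM ler_wpM2l//.
by have := alphaP n a a; rewrite eqxx opprD addrACA subrr addr0.
Qed.

(** The summand $\frac32A^2$ is $\alpha^2 + (1-\alpha)^2/2 - \frac13$ written in [A]. *)
Let pair_bound s := 3 / 2 * A ^+ 2 + D * (2 / 3) ^+ s.

(** The common factor $3^{sm}$ is scaled out; the remaining distances [k] and [3 ^ d * k] satisfy $d
    \ge s$, so [correlation_mixing] applies. The indicator pays for $m = m'$, where the correlation
    is 1. *)
Lemma correlation_pair_limsup a s m m' :
  limsup_le (fun n => correlation R a (k * 3 ^ (s * m)) (k * 3 ^ (s * m')) n - 3^-1)
    (pair_bound s + (m == m')%:R).
Proof.
have D0 : 0 <= D by exact: mixing_const_ge0.
have pb0 : 0 <= pair_bound s.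
  by rewrite addr_ge0// mulr_ge0 ?sqr_ge0// ?expr23_ge0// divr_ge0.
wlog mm' : m m' / (m <= m')%N => [W|].
  have [/W//|/ltnW /W] := leqP m m'; rewrite eq_sym.
  by apply: eq_limsup_le => n; rewrite correlationC.
have [<-|mNm'] := eqVneq m m'.
  apply: (limsup_le_trans (limsup_le_cst 1)); last by rewrite lerDr.
  by near=> n; rewrite correlationxx; lra.
rewrite addr0.
pose d := (s * (m' - m))%N.
have sd : (s <= d)%N by rewrite leq_pmulr// subn_gt0 ltn_neqAle mNm'.
apply: (@limsup_le_geometric _ (s * m + d) _ _ D) => n.
have -> : (k * 3 ^ (s * m') = 3 ^ (s * m) * (3 ^ d * k))%N.
  rewrite mulnA -expnD /d -mulnDr subnKC// mulnC//.
rewrite [(k * 3 ^ (s * m))%N]mulnC -addnA correlation_scale.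
have := correlation_mixing C_ge0 alphaP a d n; rewrite -/D.
have : D * (2 / 3) ^+ d <= D * (2 / 3) ^+ s.
  rewrite ler_wpM2l// -(subnK sd) exprD ler_piMl ?expr23_ge0//.
  by rewrite exprn_ile1 ?divr_ge0// ler_pdivrMr//; lra.
rewrite /pair_bound ler_norml /A => ? /andP[_ ?]; lra.
Unshelve. all: by end_near. Qed.

Let V s N := trig_mean R k s N.

(** In the expanded square the limits $\frac23c^2$, $-2cA$ and $\frac32A^2$ cancel. What is left are
    the $N+1$ diagonal pairs, each of weight $(N+1)^{-2}$, and the mixing error. *)
Lemma second_moment_limsup a s N :
  limsup_le (fun n => avg n (fun q =>
      \sum_b nat_op (trig_sub (V s N) c) (fun i => centered b (fixpt a i)) q ^+ 2))
    (N.+1%:R^-1 + D * (2 / 3) ^+ s).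
Proof.
(* The index list is hidden behind an equation so that simplification does not unfold its first
   element. *)
have [ms msE] : exists ms, ms = iota 0 N.+1 by eexists.
pose w : R := N.+1%:R^-1; have w0 : 0 <= w by rewrite invr_ge0.
have wN : \sum_(m <- ms) w = 1.
  by rewrite msE big_const_seq count_predT size_iota iter_addr addr0 -[_ *+ _]mulr_natr mulVf.
pose t m := (k * 3 ^ (s * m))%N.
pose X n := c ^+ 2 * (2 / 3) +
  (\sum_(m <- ms) (- 2 * c * w) * (correlation R a 0 (t m) n - 3^-1) +
  \sum_(m <- ms) \sum_(m' <- ms)
     w * w * (correlation R a (t m) (t m') n - 3^-1)).
apply: (@eq_limsup_le _ X) => [n|].
  rewrite avg_sum_nat_op_centered /V /trig_mean -msE big_cons /= !big_cons !big_map /= correlationxx.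
  under [X in _ = _ + X]eq_bigr do rewrite big_cons big_map /=.
  rewrite /X big_split /= -[RHS]addrA; congr (_ + _).
    by rewrite mulrNN expr2; congr (_ * _); field.
  rewrite [RHS]addrA; congr (_ + _); rewrite -big_split /=; apply: eq_bigr => m _.
  by rewrite [correlation R a (k * _) 0 n]correlationC -/w -/(t m); ring.
pose Y := c ^+ 2 * (2 / 3) + (\sum_(m <- ms) (- 2 * c * w) * A +
  \sum_(m <- ms) \sum_(m' <- ms)
     w * w * (pair_bound s + (m == m')%:R)).
apply: (@limsup_le_trans _ _ X Y).
- apply: limsup_leD; first exact: limsup_le_cst.
  apply: limsup_leD.
    by apply: limsup_le_sum => m; exact: correlation_scaled_limsup.
  apply: limsup_le_sum => m; apply: limsup_le_sum => m'.
  by apply: limsup_leZ; [rewrite mulr_ge0|exact: correlation_pair_limsup].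
- by near=> n.
rewrite /Y; have -> : \sum_(m <- ms) (- 2 * c * w) * A = - 2 * c * A.
  rewrite -mulr_suml; congr (_ * _); rewrite -[RHS]mulr1 -wN mulr_sumr.
  by [].
have -> : \sum_(m <- ms) \sum_(m' <- ms)
     w * w * (pair_bound s + (m == m')%:R) = pair_bound s + w.
  rewrite (eq_big_seq (fun m => w * pair_bound s + w * w)) => [|m m_in].
    by rewrite big_split /= -!mulr_suml wN !mul1r.
  under eq_bigr do rewrite mulrDr.
  rewrite big_split /= -mulr_suml -mulr_suml wN mul1r; congr (_ + _).
  rewrite -mulr_sumr -natr_sum.
  have -> : (\sum_(m' <- ms) (m == m') = count_mem m ms)%N.
    by rewrite -sum1_count [RHS]big_mkcond /=; apply: eq_bigr => m' _; rewrite eq_sym.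
  by rewrite count_uniq_mem msE ?iota_uniq// -msE m_in mulr1.
rewrite /pair_bound /c -/w; lra.
Unshelve. all: by end_near. Qed.

End FixedDistance.
End SecondMomentBound.

(** * From functions of one letter to local functions *)

Section LocalFunctions.
Variable R : realType.
Implicit Types (a b : letter) (l : seq (R * nat)).

Lemma sum_mul l1 l2 :
  \sum_(p <- trig_mul l1 l2) p.1 = (\sum_(p <- l1) p.1) * \sum_(p <- l2) p.1.
Proof.
rewrite /trig_mul big_allpairs_dep mulr_suml; apply: eq_bigr => p _.
by rewrite mulr_sumr.
Qed.

(** Cauchy-Schwarz bounds the square by shifted squares, and block averages are insensitive to a
    fixed shift in the limit. *)
Lemma nat_op_limsup l (h : letter -> nat -> R) B M :
  (forall b q, `|h b q| <= B) ->
  limsup_le (fun n => avg n (fun q => \sum_b h b q ^+ 2)) M ->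
  limsup_le (fun n => avg n (fun q => \sum_b nat_op l (h b) q ^+ 2))
    (weight l ^+ 2 * M).
Proof.
move=> hB hM; pose H q := \sum_b h b q ^+ 2.
have HB q : `|H q| <= \sum_(b : letter) B ^+ 2.
  rewrite (le_trans (ler_norm_sum _ _ _))//; apply: ler_sum => b _.
  by rewrite normrX lerXn2r ?nnegrE// (le_trans (normr_ge0 _) (hB b q)).
pose X n := weight l * \sum_(p <- l) `|p.1| * avg n (fun q => H (q + p.2)%N).
apply: (@limsup_le_trans _ _ X (weight l * \sum_(p <- l) `|p.1| * M)).
- apply: limsup_leZ; first exact: weight_ge0.
  apply: limsup_le_sum => p; apply: limsup_leZ => //.
  exact: avg_sqr_shift_limsup HB hM.
- near=> n; rewrite /X; under eq_bigr do rewrite -avgZ.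
  rewrite -avg_sum -avgZ; apply: ler_avg => q.
  apply: le_trans (_ : \sum_b weight l * \sum_(p <- l) `|p.1| * h b (q + p.2)%N ^+ 2 <= _).
    by apply: ler_sum => b _; exact: nat_op_sqr.
  rewrite -mulr_sumr exchange_big /=.
  by under [X in _ <= _ * X]eq_bigr do rewrite mulr_sumr.
- by rewrite -mulr_suml mulrA expr2.
Unshelve. all: by end_near. Qed.

(** Coefficients of sum 0 kill the mean of [F] over the letters. For a local function read at a
    fixed offset, this mean is its odometer part. *)
Lemma nat_op_letter_function l (F : letter -> R) a q : \sum_(p <- l) p.1 = 0 ->
  nat_op l (fun i => F (fixpt a i)) q =
  \sum_b F b * nat_op l (fun i => centered R b (fixpt a i)) q.
Proof.
move=> l0; rewrite /nat_op; under [RHS]eq_bigr do rewrite mulr_sumr.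
rewrite exchange_big /=; under eq_bigr do rewrite centered_decomposition mulrDr.
rewrite big_split /= -mulr_suml l0 mul0r add0r; apply: eq_bigr => p _.
by rewrite mulr_sumr; apply: eq_bigr => b _; rewrite mulrCA.
Qed.

Lemma letter_function_sqr_le (F x : letter -> R) B : (forall b, `|F b| <= B) ->
  (\sum_b F b * x b) ^+ 2 <= 3 * B ^+ 2 * \sum_b x b ^+ 2.
Proof.
move=> FB; have B0 : 0 <= B by exact: le_trans (normr_ge0 _) (FB 0).
have sumF : \sum_b `|F b| <= 3 * B.
  rewrite (_ : 3 * B = \sum_(b : letter) B); first exact: ler_sum.
  by rewrite sum_letters; ring.
have sumFx : \sum_b `|F b| * x b ^+ 2 <= B * \sum_b x b ^+ 2.
  by rewrite mulr_sumr; apply: ler_sum => b _; rewrite ler_wpM2r// sqr_ge0.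
apply: le_trans (cauchy_schwarz_weight _ _ _) _.
have -> : 3 * B ^+ 2 * \sum_b x b ^+ 2 = 3 * B * (B * \sum_b x b ^+ 2) by ring.
apply: ler_pM => //; first exact: sumr_ge0.
by apply: sumr_ge0 => b _; rewrite mulr_ge0// sqr_ge0.
Qed.

Section Annihilator.
Variables (k : nat) (alpha C : R).
Hypothesis C_ge0 : 0 <= C.
Hypothesis alphaP : forall n a b,
  `|coincidence R k n a b - (if a == b then alpha else (1 - alpha) / 2)|
  <= C * (2 / 3) ^+ n.

Let c := 3 / 2 * (alpha - 3^-1).
Let D := C + k%:R + C * `|alpha - (1 - alpha) / 2|.
Let W : R := 2 * (`|c| + 1).

(* (V - 1)(V - c), where V is the mean of the monomials z^(k 3^(s m)), m <= N. *)
Definition annihilator s N := trig_mul (trig_sub (trig_mean R k s N) 1)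
  (trig_sub (trig_mean R k s N) c).

Lemma weight_annihilator s N : weight (annihilator s N) = W.
Proof. by rewrite weight_mul !weight_sub weight_mean normr1. Qed.

Lemma sum_annihilator s N : \sum_(p <- annihilator s N) p.1 = 0.
Proof. by rewrite sum_mul big_cons sum_mean /= addNr mul0r. Qed.

Lemma centered_norm b a : `|centered R b a| <= 1.
Proof. by rewrite /centered; case: (_ == _); rewrite ler_norml /=; apply/andP; split; lra. Qed.

Lemma annihilator_limsup a s N :
  limsup_le (fun n => avg n (fun q =>
    \sum_b nat_op (annihilator s N) (fun i => centered R b (fixpt a i)) q ^+ 2))
  (4 * (N.+1%:R^-1 + D * (2 / 3) ^+ s)).
Proof.
have := @nat_op_limsup (trig_sub (trig_mean R k s N) 1)
  (fun b => nat_op (trig_sub (trig_mean R k s N) c)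
    (fun i => centered R b (fixpt a i))) _ _ _ (second_moment_limsup C_ge0 alphaP a s N).
move=> /(_ (weight (trig_sub (trig_mean R k s N) c) * 1)).
rewrite [weight (trig_sub _ 1)]weight_sub weight_mean normr1.
rewrite (_ : (1 + 1) ^+ 2 = 4 :> R); last by ring.
move=> hM; apply: eq_limsup_le (hM _) => [n|b q]; last first.
  by apply: nat_op_bounded => i; exact: centered_norm.
by apply: eq_avg => q; apply: eq_bigr => b _; rewrite nat_op_mul.
Qed.

(** At a fixed offset [r], shifts by multiples of $3^n$ act only on the block index, where [F] is a
    function of the letter. The offsets within [L] of the end of the block have proportion at most
    $L/3^n$ and are bounded crudely by $(WB)^2$. The constant 12 is 3 from the number of letters
    times $4 = 2^2$ from the weight of $V - 1$. *)
Lemma local_function_limsup (F : letter -> nat -> R) L B a n s N :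
  (forall b i, `|F b i| <= B) ->
  (forall m b q r, (r + L <= 3 ^ m)%N -> F b (3 ^ m * q + r)%N = F (fixpt b q) r) ->
  limsup_le (fun m => avg m (fun i =>
      nat_op (trig_dilate (3 ^ n) (annihilator s N)) (F a) i ^+ 2))
    (12 * B ^+ 2 * (N.+1%:R^-1 + D * (2 / 3) ^+ s) + (W * B) ^+ 2 * L%:R / 3 ^+ n).
Proof.
move=> FB Floc; set P := trig_dilate _ _.
pose e b i := nat_op (annihilator s N) (fun i => centered R b (fixpt a i)) i.
pose X m := avg m (fun q => \sum_b e b q ^+ 2).
have X_ge0 m : 0 <= X m.
  by rewrite -(avg_cst m 0); apply: ler_avg => q; apply: sumr_ge0 => b _; exact: sqr_ge0.
have W_ge0 : 0 <= W by rewrite -(weight_annihilator 0 0) weight_ge0.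
have B_ge0 : 0 <= B by exact: le_trans (normr_ge0 _) (FB 0 0%N).
pose Y : R := (W * B) ^+ 2.
have Y_ge0 : 0 <= Y by exact: sqr_ge0.
apply: (@limsup_le_shift _ n).
apply: (@limsup_le_trans _ _ (fun m => 3 * B ^+ 2 * X m + Y * L%:R / 3 ^+ n)
  (3 * B ^+ 2 * (4 * (N.+1%:R^-1 + D * (2 / 3) ^+ s)) + Y * L%:R / 3 ^+ n)).
- apply: limsup_leD; last exact: limsup_le_cst.
  by apply: limsup_leZ; [rewrite mulr_ge0 ?sqr_ge0|exact: annihilator_limsup].
- near=> m; rewrite avg_blocks.
  apply: (@le_trans _ _ (avg n (fun r =>
    3 * B ^+ 2 * X m + (if (r + L <= 3 ^ n)%N then 0 else Y)))).
    apply: ler_avg => r; case: ifPn => [rL|_]; last first.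
      apply: ler_wpDl; first by rewrite mulr_ge0// mulr_ge0 ?sqr_ge0.
      rewrite -(avg_cst m Y); apply: ler_avg => q.
      rewrite -real_normK ?num_real// lerXn2r ?nnegrE//.
        exact: mulr_ge0.
      rewrite -(weight_annihilator s N) -(weight_dilate (3 ^ n)).
      exact: nat_op_bounded.
    rewrite addr0 /X -avgZ; apply: ler_avg => q.
    have -> : nat_op P (F a) (3 ^ n * q + r) =
        nat_op (annihilator s N) (fun i => F (fixpt a i) r) q.
      rewrite /nat_op big_map; apply: eq_bigr => p _ /=.
      by rewrite addnAC -mulnDr Floc.
    rewrite (nat_op_letter_function (fun b => F b r)) ?sum_annihilator//.
    by apply: letter_function_sqr_le => b; exact: FB.
  rewrite avgD avg_cst lerD2l.
  have := @avg_close R n L (fun r => if (r + L <= 3 ^ n)%N then 0 else Y) (fun=> 0) Y.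
  rewrite avg_cst subr0 => close; apply: le_trans (ler_norm _) (close _ _) => i.
    by rewrite subr0; case: ifP; rewrite ?normr0// ger0_norm.
  by move=> iL; rewrite ltnW.
- by rewrite /Y lerD2r mulrA (_ : 3 * B ^+ 2 * 4 = 12 * B ^+ 2)//; ring.
Unshelve. all: by end_near. Qed.

End Annihilator.
End LocalFunctions.

(** An exact count: for each letter, 15 of the first 81 positions agree with the position two
    further on, and level 4 is within $3/81$ of the limit. So $\alpha \le 18/81 < 1/3$. *)
Lemma limit_neq_third (R : realType) (alpha : R) :
  (forall n, `|diag_mean R 2 n - alpha| <= 3 / 2 * (2%:R / 3 ^+ n)) ->
  alpha != 3^-1.
Proof.
move=> /(_ 4%N).
have E (a : letter) : coincidence R 2 4 a a = 15 / 81.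
  rewrite /coincidence /avg.
  (* Words of level 5 are read because [i + 2] can pass the end of the word of level 4. *)
  have -> : \sum_(0 <= i < (3 ^ 4)%N) (fixpt a (i + 2) == fixpt a i)%:R =
      (\sum_(0 <= i < (3 ^ 4)%N)
         (nth 0%R (iter_zeta 5 a) (i + 2) == nth 0%R (iter_zeta 5 a) i))%N%:R :> R.
    rewrite natr_sum; apply: eq_big_nat => i /andP[_ i4].
    have i3 : (i < 81)%N := i4.
    by rewrite !iter_zeta_fixpt//; lia.
  have -> : (\sum_(0 <= i < (3 ^ 4)%N)
       (nth 0%R (iter_zeta 5 a) (i + 2) == nth 0%R (iter_zeta 5 a) i) = 15)%N.
    rewrite unlock; move: a; apply: letter_cases; vm_compute; reflexivity.
  by field.
rewrite /diag_mean !E ler_norml => /andP[? ?]; apply/eqP => aE.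
lra.
Qed.

(** * Cylinders and density in L2 *)

Section ShiftSpace.
Implicit Types (x y : int -> letter) (i j : int) (n : nat).

Lemma window_eqP x y i n : (window x i n = window y i n) <->
  (forall j : nat, (j < n)%N -> x (i + j%:Z) = y (i + j%:Z)).
Proof.
split=> [E j jn|E]; last first.
  by apply/eq_in_map => j; rewrite mem_iota add0n => /E.
have := congr1 (fun s => nth 0 s j) E.
by rewrite !(nth_map 0%N) ?size_iota// nth_iota.
Qed.

Lemma nth_window x i n (j : nat) : (j < n)%N -> nth 0 (window x i n) j = x (i + j%:Z).
Proof. by move=> jn; rewrite (nth_map 0%N) ?size_iota// nth_iota. Qed.

Lemma size_window x i n : size (window x i n) = n.
Proof. by rewrite size_map size_iota. Qed.

Lemma measurable_coord i (a : letter) :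
  measurable ([set x | x i = a] : set borel_shift).
Proof.
apply: sub_sigma_algebra.
have : open ((proj i : {ptws int -> discrete_topology letter} -> _) @^-1` [set a]).
  by apply: open_comp; [move=> ? _; exact: proj_continuous|exact: discrete_open].
by [].
Qed.

Lemma measurable_window i n (w : seq letter) :
  measurable ([set x | window x i n = w] : set borel_shift).
Proof.
have [wn|wn] := eqVneq (size w) n; last first.
  rewrite (_ : [set _ | _] = set0)//; apply/seteqP; split=> // x /= E.
  by move: wn; rewrite -E size_window eqxx.
rewrite (_ : [set _ | _] =
    \bigcap_(j in [set j : nat | (j < n)%N]) [set x | x (i + j%:Z) = nth 0 w j]).
  by apply: bigcap_measurableType => j _; exact: measurable_coord.
apply/seteqP; split=> x /= E.
  by move=> j /= jn; rewrite -E nth_window.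
by apply: (@eq_from_nth _ 0); rewrite size_window// => j jn; rewrite nth_window// E.
Qed.

Definition central n x := window x (- n%:Z) (2 * n + 1).

Lemma central_eqP n x y : central n x = central n y <->
  (forall i, (`|i| <= n)%N -> x i = y i).
Proof.
split=> [/window_eqP E i iN|E].
  have := E (absz (i + n%:Z)); rewrite (_ : - n%:Z + _ = i); last by lia.
  by apply; lia.
by apply/window_eqP => j jn; apply: E; lia.
Qed.

Lemma central_widen n m x y : (n <= m)%N -> central m x = central m y ->
  central n x = central n y.
Proof.
by move=> nm /central_eqP E; apply/central_eqP => i /leq_trans/(_ nm); exact: E.
Qed.

Lemma measurable_central_preimage n (S : set (seq letter)) :
  measurable (central n @^-1` S : set borel_shift).
Proof.
rewrite (_ : _ @^-1` _ = \bigcup_w (if `[< S w >] then [set x | central n x = w] else set0)).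
  apply: countable_bigcupT_measurable => // w.
  by case: ifP => _; [exact: measurable_window|exact: measurable0].
apply/seteqP; split=> [x Sx|x [w _]]; first by exists (central n x); rewrite ?asboolT.
by case: ifPn => [/asboolP Sw /= ->|].
Qed.

(** Otherwise points outside [U] that agree with [x] on growing windows would converge to [x]
    pointwise. *)
Lemma open_central (U : set {ptws int -> discrete_topology letter}) x :
  open U -> U x -> exists n, forall y, central n y = central n x -> U y.
Proof.
move=> oU Ux; apply: contrapT => /forallNP noN.
have /choice[y yP] n : exists y, central n y = central n x /\ ~ U y.
  by have /existsNP[y /not_implyP[? ?]] := noN n; exists y.
have yx : (y : nat -> {ptws int -> discrete_topology letter}) @ \oo -->
    (x : {ptws int -> discrete_topology letter}).
  apply/(@pointwise_cvgP (discrete_topology int) (discrete_topology letter)) => i A /nbhs_singleton Axi.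
  exists `|i|%N => // n /= iN.
  by have [/central_eqP E _] := yP n; rewrite /= E.
have [N _ NU] : \forall n \near \oo, U (y n) by apply: yx; exact: open_nbhs_nbhs.
by have [_] := yP N; apply; apply: NU => /=.
Qed.

End ShiftSpace.

Section SquareNorm.
Context d (T : measurableType d) (R : realType) (m : {measure set T -> \bar R}).
Implicit Types (f g : T -> R).

Definition sqnorm f : \bar R := (\int[m]_x ((f x ^+ 2)%:E))%E.

Lemma measurable_sqr f : measurable_fun setT f ->
  measurable_fun setT (fun x => (f x ^+ 2)%:E).
Proof. by move=> mf; apply/measurable_EFinP; exact: measurable_funX. Qed.

Lemma sqnormZ c f : measurable_fun setT f ->
  sqnorm (fun x => c * f x) = ((c ^+ 2)%:E * sqnorm f)%E.
Proof.
move=> mf; rewrite /sqnorm -ge0_integralZl//.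
- by apply: eq_integral => x _; rewrite exprMn EFinM.
- exact: measurable_sqr.
- by move=> x _; rewrite lee_fin sqr_ge0.
- by rewrite lee_fin sqr_ge0.
Qed.

Lemma sqnormD_le f g : measurable_fun setT f -> measurable_fun setT g ->
  (sqnorm (fun x => f x + g x)%R <= 2%:E * sqnorm f + 2%:E * sqnorm g)%E.
Proof.
move=> mf mg; rewrite /sqnorm -!ge0_integralZl//; last 4 first.
- exact: measurable_sqr.
- by move=> x _; rewrite lee_fin sqr_ge0.
- exact: measurable_sqr.
- by move=> x _; rewrite lee_fin sqr_ge0.
rewrite -ge0_integralD//; last 4 first.
- by move=> x _; rewrite mule_ge0// lee_fin sqr_ge0.
- by apply: measurable_funeM; exact: measurable_sqr.
- by move=> x _; rewrite mule_ge0// lee_fin sqr_ge0.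
- by apply: measurable_funeM; exact: measurable_sqr.
apply: ge0_le_integral => //.
- by move=> x _; rewrite lee_fin sqr_ge0.
- by apply: measurable_sqr; exact: measurable_funD.
- by apply: emeasurable_funD; apply: measurable_funeM; exact: measurable_sqr.
- move=> x _; rewrite -!EFinM -EFinD lee_fin.
  by have := sqr_ge0 (f x - g x); nra.
Qed.

(** Stands in for the triangle inequality; the quarters come from $(f+g)^2 \le 2f^2 + 2g^2$. *)
Lemma sqnormD_le_quarter f g e : measurable_fun setT f -> measurable_fun setT g ->
  (sqnorm f <= (e / 4)%:E -> sqnorm g <= (e / 4)%:E ->
  sqnorm (fun x => f x + g x)%R <= e%:E)%E.
Proof.
move=> mf mg fe ge; apply: le_trans (sqnormD_le mf mg) _.
have -> : e%:E = (2%:E * (e / 4)%:E + 2%:E * (e / 4)%:E)%E.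
  by rewrite -!EFinM -EFinD; congr EFin; lra.
by apply: leeD; apply: lee_wpmul2l.
Qed.

End SquareNorm.

(** * Approximation by clopen sets and cylinder functions *)

Section Approximation.
Variables (R : realType) (mu : probability borel_shift R).
Implicit Types (A B C : set borel_shift) (f g : borel_shift -> R).

Definition determined n A :=
  forall x y, central n x = central n y -> A x -> A y.

Lemma determined_measurable n A : determined n A -> measurable A.
Proof.
move=> nA; rewrite (_ : A = central n @^-1` [set w | exists2 x, A x & central n x = w]).
  exact: measurable_central_preimage.
by apply/seteqP; split=> [x Ax|x [y Ay yx]]; [exists x|exact: nA yx Ay].
Qed.

Lemma determinedC n A : determined n A -> determined n (~` A).
Proof. by move=> nA x y xy nAx Ay; apply: nAx; exact: nA (esym xy) Ay. Qed.

Lemma determined_widen n p A : (n <= p)%N -> determined n A -> determined p A.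
Proof. by move=> np nA x y /(central_widen np); exact: nA. Qed.

Lemma determinedU n A B : determined n A -> determined n B -> determined n (A `|` B).
Proof. by move=> nA nB x y xy [Ax|Bx]; [left; exact: nA Ax|right; exact: nB Bx]. Qed.

Definition clopen_approx A := measurable A /\ forall e : R, 0 < e ->
  exists n C, determined n C /\ (mu ((A `\` C) `|` (C `\` A)) <= e%:E)%E.

Lemma clopen_approx0 : clopen_approx set0.
Proof.
split; [exact: measurable0|move=> e e0; exists 0%N, set0; split=> //].
by rewrite !setD0 setU0 measure0 lee_fin ltW.
Qed.

Lemma clopen_approxC A : clopen_approx A -> clopen_approx (~` A).
Proof.
move=> [mA hA]; split; [exact: measurableC|move=> e /hA[n [C [nC muC]]]].
exists n, (~` C); split; first exact: determinedC.
apply: le_trans muC; rewrite le_eqVlt; apply/orP; left; apply/eqP; congr (mu _).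
by rewrite !setDE !setCK setUC setIC; congr (_ `|` _); rewrite setIC.
Qed.

Lemma measurable_symdiff A B : measurable A -> measurable B ->
  measurable ((A `\` B) `|` (B `\` A)).
Proof. by move=> mA mB; apply: measurableU; exact: measurableD. Qed.

Lemma clopen_approxU A B : clopen_approx A -> clopen_approx B ->
  clopen_approx (A `|` B).
Proof.
move=> [mA hA] [mB hB]; split; [exact: measurableU|move=> e e0].
have e20 : 0 < e / 2 by rewrite divr_gt0.
have [n [C [nC muC]]] := hA _ e20; have [p [D [pD muD]]] := hB _ e20.
have mC := determined_measurable nC; have mD := determined_measurable pD.
exists (maxn n p), (C `|` D); split.
  apply: determinedU; first exact: determined_widen (leq_maxl _ _) nC.
  exact: determined_widen (leq_maxr _ _) pD.
apply: (@le_trans _ _ (mu (((A `\` C) `|` (C `\` A)) `|` ((B `\` D) `|` (D `\` B))))).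
  apply: le_measure; rewrite ?inE.
  - by apply: measurable_symdiff; exact: measurableU.
  - by apply: measurableU; exact: measurable_symdiff.
  - by move=> x /= ; tauto.
apply: le_trans (measureU2 _ _ _) _; try exact: measurable_symdiff.
by rewrite [e]splitr EFinD; exact: leeD.
Qed.

(** Since [mu] is finite, continuity from above leaves measure at most $e/2$ outside a finite union,
    which is then approximated to within $e/2$. *)
Lemma clopen_approx_bigcup (F : nat -> set borel_shift) :
  (forall n, clopen_approx (F n)) -> clopen_approx (\bigcup_n F n).
Proof.
move=> hF; pose G n := \big[setU/set0]_(i < n.+1) F i.
have hG n : clopen_approx (G n).
  rewrite /G; elim: n.+1 => [|k IH]; first by rewrite big_ord0; exact: clopen_approx0.
  by rewrite big_ord_recr; exact: clopen_approxU.
have mU : measurable (\bigcup_n F n) by apply: bigcupT_measurable => n; have [] := hF n.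
split=> // e e0; have e20 : 0 < e / 2 by rewrite divr_gt0.
have GU : \bigcup_n G n = \bigcup_n F n by rewrite bigcup_bigsetU_bigcup.
have mG n : measurable (G n) by have [] := hG n.
pose D n := (\bigcup_n F n) `\` G n.
have mD n : measurable (D n) by exact: measurableD.
have D0 : \bigcap_n D n = set0.
  apply/seteqP; split=> // x Dx; have [] := Dx 0%N I.
  by rewrite -GU => -[n _ Gnx] _; have [_] := Dx n I.
have muD : mu \o D @ \oo --> mu (\bigcap_n D n).
  apply: nonincreasing_cvg_mu => //.
  - by rewrite (le_lt_trans (probability_le1 _ _))// ltry.
  - by rewrite D0; exact: measurable0.
  - apply/nonincreasing_seqP => n; apply/subsetPset; apply: setDS.
    by rewrite /G [X in _ `<=` X]big_ord_recr /=; exact: subsetUl.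
rewrite D0 measure0 in muD.
have [n muDn] : exists n, (mu (D n) <= (e / 2)%:E)%E.
  move/fine_cvgP : muD => [_ /cvgrPdist_le/(_ _ e20)][N _ /(_ N (leqnn N))].
  rewrite /= sub0r normrN => DN; exists N.
  by rewrite -[mu _]fineK ?fin_num_measure// lee_fin (le_trans (ler_norm _) DN).
have [_ /(_ _ e20)[p [C [pC muC]]]] := hG n.
have mC := determined_measurable pC.
exists p, C; split=> //.
apply: (@le_trans _ _ (mu (D n `|` ((G n `\` C) `|` (C `\` G n))))).
  apply: le_measure; rewrite ?inE.
  - exact: measurable_symdiff.
  - by apply: measurableU => //; exact: measurable_symdiff.
  - have GF x : G n x -> (\bigcup_n F n) x by rewrite -GU; exists n.
    move=> x /=; rewrite /D /=; have := GF x; have := EM (G n x); tauto.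
apply: le_trans (measureU2 _ _ _) _ => //; first exact: measurable_symdiff.
by rewrite [e]splitr EFinD; exact: leeD.
Qed.

(** The approximable sets form a sigma-algebra, and every open set is a countable union of clopen
    sets. *)
Lemma measurable_clopen_approx A : measurable A -> clopen_approx A.
Proof.
suff: <<s @open {ptws int -> discrete_topology letter} >> `<=` clopen_approx.
  by apply.
apply: smallest_sub.
  split; [exact: clopen_approx0|by move=> B hB; rewrite setTD; exact: clopen_approxC|].
  exact: clopen_approx_bigcup.
move=> U oU.
pose S n := [set w | forall y, central n y = w -> U y].
rewrite (_ : U = \bigcup_n (central n @^-1` S n : set borel_shift)).
  apply: clopen_approx_bigcup => n; split; first exact: measurable_central_preimage.
  move=> e e0; exists n, (central n @^-1` S n); split.
    by move=> x y /= ->.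
  by rewrite setDv setU0 measure0 lee_fin ltW.
apply/seteqP; split=> [x Ux|x [n _]]; last by apply.
by have [n nU] := open_central oU Ux; exists n.
Qed.

End Approximation.

Section L2Approximation.
Variables (R : realType) (mu : probability borel_shift R).
Implicit Types (A : set borel_shift) (f g F : borel_shift -> R).

Definition cylinder_fun f := exists n,
  (forall x y, central n x = central n y -> f x = f y) /\
  exists M : R, forall x, `|f x| <= M.

Lemma cylinder_fun_measurable f : cylinder_fun f -> measurable_fun setT f.
Proof.
move=> [n [nf _]] _ Y _; rewrite setTI; apply: (@determined_measurable n).
by move=> x y /nf /= ->.
Qed.

Lemma cylinder_funD f g :
  cylinder_fun f -> cylinder_fun g -> cylinder_fun (fun x => f x + g x).
Proof.
move=> [n [nf [B fB]]] [p [pg [C gC]]]; exists (maxn n p); split.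
  move=> x y xy; congr (_ + _).
    exact/nf/(central_widen (leq_maxl n p)).
  exact/pg/(central_widen (leq_maxr n p)).
exists (B + C) => x; rewrite (le_trans (ler_normD _ _))//.
by rewrite lerD.
Qed.

Lemma cylinder_funZ c f : cylinder_fun f -> cylinder_fun (fun x => c * f x).
Proof.
move=> [n [nf [B fB]]]; exists n; split; first by move=> x y /nf ->.
by exists (`|c| * B) => x; rewrite normrM ler_wpM2l.
Qed.

Lemma cylinder_fun_indic n A : determined n A -> cylinder_fun (\1_A : _ -> R).
Proof.
move=> nA; exists n; split.
  move=> x y xy; rewrite !indicE; congr (_ : bool)%:R; apply/idP/idP; rewrite !inE.
    exact: nA xy.
  exact: nA (esym xy).
by exists 1 => x; rewrite indicE; case: (_ \in _); rewrite ?normr1 ?normr0.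
Qed.

Definition L2_approx F := measurable_fun setT F /\ forall e : R, 0 < e ->
  exists f, cylinder_fun f /\ (sqnorm mu (fun x => F x - f x)%R <= e%:E)%E.

Lemma L2_approx_cylinder f : cylinder_fun f -> L2_approx f.
Proof.
move=> hf; split; [exact: cylinder_fun_measurable|move=> e e0; exists f; split=> //].
rewrite /sqnorm integral0_eq ?lee_fin ?ltW// => x _.
by rewrite subrr expr0n.
Qed.

Lemma L2_approx_indic A : measurable A -> L2_approx (\1_A : _ -> R).
Proof.
move=> mA; split; [exact: measurable_indic|move=> e e0].
have [_ /(_ e e0)[n [C [nC muC]]]] := measurable_clopen_approx mu mA.
have mC := determined_measurable nC.
exists (\1_C); split; first exact: cylinder_fun_indic nC.
apply: le_trans muC; rewrite -(setIT (_ `|` _)) -integral_indic//; last first.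
  exact: measurable_symdiff.
rewrite le_eqVlt; apply/orP; left; apply/eqP; apply: eq_integral => x _.
congr EFin; rewrite !indicE in_setU !in_setD.
by case: (x \in A); case: (x \in C); rewrite /= ?subrr ?subr0 ?sub0r ?sqrrN ?expr0n ?expr1n.
Qed.

Lemma L2_approx_limit F (G : nat -> borel_shift -> R) : measurable_fun setT F ->
  (forall n, L2_approx (G n)) ->
  (forall e : R, 0 < e -> exists n, (sqnorm mu (fun x => F x - G n x)%R <= e%:E)%E) ->
  L2_approx F.
Proof.
move=> mF GA FG; split=> // e e0; have e40 : 0 < e / 4 by rewrite divr_gt0.
have [n Fn] := FG _ e40; have [mG /(_ _ e40)[f [hf Gf]]] := GA n.
exists f; split=> //; have mf := cylinder_fun_measurable hf.
rewrite (_ : (fun _ => _) = fun x => (F x - G n x) + (G n x - f x)); last first.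
  by apply/funext => x; rewrite subrKA.
by apply: sqnormD_le_quarter => //; exact: measurable_funB.
Qed.

Lemma L2_approxD F G : L2_approx F -> L2_approx G -> L2_approx (fun x => F x + G x).
Proof.
move=> [mF hF] [mG hG]; split; [exact: measurable_funD|move=> e e0].
have e40 : 0 < e / 4 by rewrite divr_gt0.
have [f [cf Ff]] := hF _ e40; have [g [cg Gg]] := hG _ e40.
have mf := cylinder_fun_measurable cf; have mg := cylinder_fun_measurable cg.
exists (fun x => f x + g x); split; first exact: cylinder_funD.
rewrite (_ : (fun _ => _) = fun x => (F x - f x) + (G x - g x)); last first.
  by apply/funext => x; rewrite opprD addrACA.
by apply: sqnormD_le_quarter => //; exact: measurable_funB.
Qed.

Lemma L2_approxZ c F : L2_approx F -> L2_approx (fun x => c * F x).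
Proof.
move=> [mF hF]; split; first exact: measurable_funM.
move=> e e0; have e'0 : 0 < e / (c ^+ 2 + 1) by rewrite divr_gt0// ltr_wpDl ?sqr_ge0.
have [f [cf Ff]] := hF _ e'0; have mf := cylinder_fun_measurable cf.
exists (fun x => c * f x); split; first exact: cylinder_funZ.
rewrite (_ : (fun _ => _) = fun x => c * (F x - f x)); last first.
  by apply/funext => x; rewrite mulrBr.
rewrite sqnormZ; last exact: measurable_funB.
apply: (@le_trans _ _ ((c ^+ 2)%:E * (e / (c ^+ 2 + 1))%:E)%E).
  by apply: lee_wpmul2l => //; rewrite lee_fin sqr_ge0.
rewrite -EFinM lee_fin mulrA ler_pdivrMr ?ltr_wpDl ?sqr_ge0//.
by rewrite mulrC ler_wpM2l ?ltW// ltrDl.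
Qed.

Lemma L2_approx_sum (I : Type) (s : seq I) (G : I -> borel_shift -> R) :
  (forall i, L2_approx (G i)) -> L2_approx (fun x => \sum_(i <- s) G i x).
Proof.
move=> hG; elim: s => [|i s IH].
  rewrite (_ : (fun _ => _) = fun=> 0); last by apply/funext => x; rewrite big_nil.
  by apply: L2_approx_cylinder; exists 0%N; split=> //; exists 0 => x; rewrite normr0.
rewrite (_ : (fun _ => _) = fun x => G i x + \sum_(j <- s) G j x).
  exact: L2_approxD.
by apply/funext => x; rewrite big_cons.
Qed.

Import HBNNSimple.

Lemma L2_approx_nnsfun (g : {nnsfun borel_shift >-> R}) : L2_approx g.
Proof.
rewrite (funext (fimfunEord g)).
apply: L2_approx_sum => i; apply: L2_approxZ; apply: L2_approx_indic.
exact: measurable_funPTI.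
Qed.

(** Simple functions $g_n$ increase to [F], and $(F - g_n)^2 \le F^2$ permits dominated
    convergence. *)
Lemma L2_approx_ge0 F : measurable_fun setT F -> (forall x, 0 <= F x) ->
  (sqnorm mu F < +oo)%E -> L2_approx F.
Proof.
move=> mF F0 F2.
have mEF : measurable_fun setT (EFin \o F) by exact/measurable_EFinP.
pose g n := nnsfun_approx measurableT mEF n.
apply: (@L2_approx_limit F g) => // [n|e e0]; first exact: L2_approx_nnsfun.
have gF n x : 0 <= g n x <= F x.
  rewrite fun_ge0 /=.
  rewrite -lee_fin /g nnsfun_approxE; apply: (@le_approx _ _ _ _ (EFin \o F)) => //.
  by move=> y _; rewrite lee_fin.
have [|||||_ + _] := @dominated_convergence _ _ _ mu setT measurableT
  (fun n x => ((F x - g n x) ^+ 2)%:E) (cst 0%E) (fun x => (F x ^+ 2)%:E).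
- by move=> n; apply: measurable_sqr; exact: measurable_funB.
- exact: measurable_cst.
- apply: aeW => x _.
  have F0' y : setT y -> (0 <= (EFin \o F) y)%E by rewrite lee_fin.
  have /fine_cvgP[_ /= gx] := cvg_nnsfun_approx measurableT mEF F0' (x := x) I.
  apply/fine_cvgP; split; first by near=> n.
  rewrite /= -[X in _ --> X](_ : (F x - F x) ^+ 2 = 0); last by rewrite subrr expr0n.
  by apply: cvgM; (apply: cvgB; [exact: cvg_cst|exact: gx]).
- apply/integrableP; split; first exact: measurable_sqr.
  by under eq_integral do rewrite gee0_abs ?lee_fin ?sqr_ge0//.
- apply: aeW => x n _; rewrite gee0_abs ?lee_fin ?sqr_ge0//.
  by have /andP[? ?] := gF n x; rewrite lerXn2r ?nnegrE ?subr_ge0 ?gerBl.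
move=> /fine_cvgP[fin_int /cvgrPdist_le/(_ e e0) small_int].
have [N _ /(_ N (leqnn N)) /= [fN]] := filterI fin_int small_int.
rewrite sub0r normrN => hN; exists N.
rewrite (_ : sqnorm _ _ = \int[mu]_x `|((F x - g N x) ^+ 2)%:E - cst 0%R x|)%E.
  by rewrite -[X in (X <= _)%E]fineK// lee_fin (le_trans (ler_norm _) hN).
by apply: eq_integral => x _; rewrite sube0 gee0_abs// lee_fin sqr_ge0.
Unshelve. all: by end_near. Qed.

Lemma max_decomposition (t : R) : t = Num.max t 0 + -1 * Num.max (- t) 0.
Proof. by rewrite /Num.max; do 2! case: ifP; lra. Qed.

Lemma sqnorm_approx F : measurable_fun setT F -> (sqnorm mu F < +oo)%E -> L2_approx F.
Proof.
move=> mF F2; pose Fp x := Num.max (F x) 0; pose Fn x := Num.max (- F x) 0.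
have mFp : measurable_fun setT Fp by exact: measurable_maxr.
have mFn : measurable_fun setT Fn by apply: measurable_maxr => //; exact: measurableT_comp.
have sq_le (G : borel_shift -> R) : measurable_fun setT G -> (forall x, `|G x| <= `|F x|) ->
    (sqnorm mu G < +oo)%E.
  move=> mG GF; apply: le_lt_trans F2; apply: ge0_le_integral => //.
  - by move=> x _; rewrite lee_fin sqr_ge0.
  - exact: measurable_sqr.
  - exact: measurable_sqr.
  - move=> x _; rewrite lee_fin -[F x ^+ 2]real_normK ?num_real//.
    by rewrite -[G x ^+ 2]real_normK ?num_real// lerXn2r ?nnegrE.
rewrite (_ : F = fun x => Fp x + (-1) * Fn x); last first.
  by apply/funext => x; exact: max_decomposition.
apply: L2_approxD; last apply: L2_approxZ; apply: L2_approx_ge0 => //.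
- by move=> x; rewrite le_max lexx orbT.
- apply: sq_le => // x; rewrite /Fp ger0_norm ?le_max ?lexx ?orbT//.
  by rewrite ge_max ler_norm normr_ge0.
- by move=> x; rewrite le_max lexx orbT.
- apply: sq_le => // x; rewrite /Fn ger0_norm ?le_max ?lexx ?orbT//.
  by rewrite ge_max -normrN ler_norm normr_ge0.
Qed.

End L2Approximation.

(** * The shift on L2 *)

Section Dynamics.
Variable R : realType.
Implicit Types (f g : borel_shift -> R) (x : borel_shift).

Lemma shift_shift k l (x : int -> letter) : shift k (shift l x) = shift (k + l) x.
Proof. by apply/funext => j; rewrite /shift addrA. Qed.

Lemma shift0 (x : int -> letter) : shift 0 x = x.
Proof. by apply/funext => j; rewrite /shift addr0. Qed.

Lemma central_shift n (k : int) (x y : int -> letter) :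
  central (n + `|k|) x = central (n + `|k|) y ->
  central n (shift k x) = central n (shift k y).
Proof.
by move=> /central_eqP E; apply/central_eqP => i iN; apply: E; lia.
Qed.

Lemma measurable_shift k :
  measurable_fun setT (shift k : borel_shift -> borel_shift).
Proof.
apply: (@measurability _ _ borel_shift borel_shift setT _
  (@open {ptws int -> discrete_topology letter}) erefl).
move=> _ [U oU <-]; rewrite setTI.
rewrite (_ : _ @^-1` _ = \bigcup_n [set x : borel_shift |
    forall y, central n y = central n (shift k x) -> U y]).
  apply: bigcupT_measurable => n; apply: (@determined_measurable (n + `|k|)).
  by move=> x y /central_shift /= ->.
apply/seteqP; split=> [x /= Ux|x [n _]]; last by apply.
by have [n nU] := open_central oU Ux; exists n.
Qed.

Lemma measurable_fun_shift k f : measurable_fun setT f ->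
  measurable_fun setT (fun x : borel_shift => f (shift k x)).
Proof. by move=> mf; exact: measurableT_comp mf (measurable_shift k). Qed.

(** Central windows suffice: each window is a factor of a central one, and the language is closed
    under factors. *)
Lemma measurable_subshift : measurable (subshift zeta : set borel_shift).
Proof.
rewrite (_ : subshift zeta = \bigcap_n [set x : borel_shift |
    in_language zeta (central n x)]).
  apply: bigcap_measurableType => n _; apply: (@determined_measurable n).
  by move=> x y /= ->.
apply/seteqP; split=> x /= hx; first by move=> n _; exact: hx.
move=> i n; have [k [a /infixP[s [s' E]]]] := hx (`|i| + n)%N I.
exists k, a.
apply: (infix_trans _ (_ : infix (central (`|i| + n) x) _)); last first.
  by apply/infixP; exists s, s'.
apply/infixP; pose m := (`|i| + n)%N.
pose p := absz (i + m%:Z)%R.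
exists (take p (central m x)), (drop (p + n) (central m x)).
rewrite catA -{1}(cat_take_drop (p + n) (central m x)); congr (_ ++ _).
rewrite takeD; congr (_ ++ _).
apply: (@eq_from_nth _ 0).
  rewrite size_takel ?size_window// size_drop size_window /p /m; lia.
move=> j; rewrite size_takel ?size_drop ?size_window; last by rewrite /p /m; lia.
move=> jn; rewrite nth_take// nth_drop !nth_window//; last by rewrite /p /m; lia.
by congr x; rewrite /p /m; lia.
Qed.

Variable mu : probability borel_shift R.
Hypothesis mu_inv : invariant_on (subshift zeta) mu.

Lemma invariant_shift (k : nat) (A : set borel_shift) : measurable A ->
  mu (shift k%:Z @^-1` A) = mu A.
Proof.
move=> mA; elim: k => [|k IH].
  by congr (mu _); apply/funext => x; rewrite /preimage /= shift0.
rewrite -[RHS]IH -[RHS]mu_inv.2; last first.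
  by rewrite -[X in measurable X]setTI; exact: measurable_shift.
congr (mu _); apply/funext => x; rewrite /preimage /= shift_shift.
by rewrite [k.+1%:Z]intS addrC.
Qed.

Lemma ge0_integral_shift (k : nat) (f : borel_shift -> \bar R) :
  measurable_fun setT f -> (forall x, (0 <= f x)%E) ->
  (\int[mu]_x f (shift k%:Z x) = \int[mu]_x f x)%E.
Proof.
move=> mf f0; have := @ge0_integral_pushforward _ _ borel_shift borel_shift R
  (shift k%:Z) (measurable_shift k%:Z) mu setT f measurableT mf (fun x _ => f0 x).
rewrite preimage_setT => <-; apply: eq_measure_integral => [|mshift A mA _].
  exact: measurable_shift.
exact: invariant_shift.
Qed.

Lemma integral_subshift_le f (M : R) : measurable_fun setT f ->
  (forall x, 0 <= f x) -> (forall x, subshift zeta x -> f x <= M) ->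
  (\int[mu]_x (f x)%:E <= M%:E)%E.
Proof.
move=> mf f0 fM; have mX := measurable_subshift.
have muX : mu (~` (subshift zeta : set borel_shift)) = 0%E.
  by rewrite probability_setC//= mu_inv.1 subee.
rewrite (@ge0_negligible_integral _ _ _ _ _ (~` (subshift zeta : set borel_shift)))//.
- rewrite setDE setTI setCK.
  apply: (@le_trans _ _ (\int[mu]_(x in (subshift zeta : set borel_shift)) (cst M%:E x))%E).
    apply: (ge0_le_integral mu mX).
    + by move=> x _; rewrite lee_fin.
    + by apply/measurable_EFinP; apply: measurable_funS mf.
    + exact: measurable_cst.
    + by move=> x Xx; rewrite lee_fin fM.
  by rewrite integral_cst//= mu_inv.1 mule1.
- exact: measurableC.
- exact/measurable_EFinP.
- by move=> x _; rewrite lee_fin.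
Qed.

Definition shift_op (l : seq (R * nat)) f x : R :=
  \sum_(p <- l) p.1 * f (shift p.2%:Z x).

Lemma measurable_shift_op l f : measurable_fun setT f ->
  measurable_fun setT (shift_op l f).
Proof.
move=> mf; apply: measurable_sum => p; apply: measurable_funM => //.
exact: measurable_fun_shift.
Qed.

Lemma sqnorm_shift_op l f : measurable_fun setT f ->
  (sqnorm mu (shift_op l f) <= (weight l ^+ 2)%:E * sqnorm mu f)%E.
Proof.
move=> mf; have mfs k := measurable_fun_shift k mf.
apply: (@le_trans _ _ (\int[mu]_x
    ((weight l)%:E * \sum_(p <- l) `|p.1|%:E * (f (shift p.2%:Z x) ^+ 2)%:E))%E).
  apply: ge0_le_integral => //.
  - by move=> x _; rewrite lee_fin sqr_ge0.
  - by apply: measurable_sqr; exact: measurable_shift_op.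
  - apply: measurable_funeM; apply: emeasurable_sum => p.
    by apply: measurable_funeM; exact: measurable_sqr.
  - move=> x _; under eq_bigr do rewrite -EFinM.
    by rewrite sumEFin -EFinM lee_fin; exact: cauchy_schwarz_weight.
rewrite ge0_integralZl//.
- rewrite ge0_integral_sum//.
  + rewrite expr2 EFinM -muleA lee_wpmul2l ?lee_fin ?weight_ge0//.
    rewrite /weight -sumEFin ge0_sume_distrl; last by move=> p _; rewrite lee_fin.
    apply: lee_sum => p _; rewrite ge0_integralZl//.
    - rewrite (ge0_integral_shift p.2 (measurable_sqr mf))// => x.
      by rewrite lee_fin sqr_ge0.
    - exact: measurable_sqr.
    - by move=> x _; rewrite lee_fin sqr_ge0.
  + by move=> p; apply: measurable_funeM; exact: measurable_sqr.
  + by move=> p x _; rewrite mule_ge0// lee_fin sqr_ge0.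
- apply: emeasurable_sum => p.
  by apply: measurable_funeM; exact: measurable_sqr.
- by move=> x _; apply: sume_ge0 => p _; rewrite mule_ge0// lee_fin sqr_ge0.
- by rewrite lee_fin weight_ge0.
Qed.

End Dynamics.

(** * From the fixed points to the invariant measure *)

Section OrbitAverage.
Variables (R : realType) (mu : probability borel_shift R).
Hypothesis mu_inv : invariant_on (subshift zeta) mu.
Implicit Types (f g : borel_shift -> R) (x : borel_shift) (b : letter).

(* Only the coordinates j >= 0 of this point are meaningful. *)
Definition fixpt_point b (i : nat) : borel_shift := fun j => fixpt b (i + `|j|).

Definition depends_on W f := forall x y,
  (forall j : nat, (j < W)%N -> x j%:Z = y j%:Z) -> f x = f y.

Lemma depends_on_shift_op W l f : depends_on W f ->
  exists W', depends_on W' (shift_op l f).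
Proof.
move=> Wf; elim: l => [|p l [W' IH]].
  by exists 0%N => x y _; rewrite /shift_op !big_nil.
exists (maxn (W + p.2) W') => x y xy; rewrite /shift_op !big_cons; congr (_ * _ + _).
  by apply: Wf => j jW; rewrite /shift -PoszD; apply: xy; lia.
by apply: IH => j jW; apply: xy; lia.
Qed.

Lemma sum_rotation (M p : nat) (h : nat -> R) :
  \sum_(0 <= j < M) h ((p + j) %% M)%N = \sum_(0 <= j < M) h j.
Proof.
elim: p => [|p IH].
  by apply: eq_big_nat => j /andP[_ jM]; rewrite add0n modn_small.
rewrite -[RHS]IH; case: M {IH} => [|M]; first by rewrite !big_geq.
rewrite big_nat_recr//= [RHS]big_nat_recl//= addrC.
congr (h _ + _).
  by rewrite addn0 addSnnS modnDr.
by apply: eq_bigr => i _; rewrite addSnnS.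
Qed.

(** A long window of [x] occurs in a fixed point at a position [p] that need not be aligned with the
    blocks. Modulo $3^H$ its positions still meet every offset once. The letters of the blocks met
    are unknown, so [g] is bounded by its sum over all letters; each of the last offsets, where [g]
    looks beyond the block, costs [B]. *)
Lemma orbit_sum_le g W B H x : subshift zeta x -> (forall y, 0 <= g y <= B) ->
  depends_on W g ->
  \sum_(0 <= j < (3 ^ H)%N) g (shift j%:Z x) <=
  \sum_b \sum_(0 <= i < (3 ^ H)%N) g (fixpt_point b i) + B * W%:R.
Proof.
move=> Xx gB Wg; set M := (3 ^ H)%N.
have g_ge0 y : 0 <= g y by have /andP[] := gB y.
have gleB y : g y <= B by have /andP[] := gB y.
have M_gt0 : (0 < M)%N by rewrite expn_gt0.
have [n [a /infixP[s [s' E]]]] := Xx 0 (M + W)%N.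
pose p := size s.
have sizeE : (p + (M + W) <= 3 ^ n)%N.
  have := congr1 size E; rewrite -/(iter_zeta n a) size_iter_zeta !size_cat size_window /p.
  by move=> ->; lia.
have xE (j : nat) : (j < M + W)%N -> x j%:Z = fixpt a (p + j).
  move=> jMW; rewrite -(@iter_zeta_fixpt n); last by lia.
  rewrite /iter_zeta E nth_cat ifF; last by rewrite ltnNge leq_addr.
  rewrite -/p addKn nth_cat size_window jMW nth_window//.
pose h i := \sum_b g (fixpt_point b i) + (if (i + W <= M)%N then 0 else B).
apply: (@le_trans _ _ (\sum_(0 <= j < M) h ((p + j) %% M)%N)).
  apply: ler_sum_nat => j /andP[_ jM].
  pose q := ((p + j) %/ M)%N; pose i := ((p + j) %% M)%N.
  have pjE : (p + j = 3 ^ H * q + i)%N by rewrite [(3 ^ H * _)%N]mulnC -divn_eq.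
  rewrite /h -/i; case: ifP => iW; last first.
    by apply: ler_wpDl => //; apply: sumr_ge0.
  rewrite addr0 (_ : g _ = g (fixpt_point (fixpt a q) i)).
    by rewrite (bigD1 (fixpt a q))//= lerDl; apply: sumr_ge0.
  apply: Wg => j' j'W; rewrite /shift -PoszD xE; last by lia.
  rewrite /fixpt_point /= -(@fixpt_block H); last by rewrite -/M; lia.
  by congr fixpt; rewrite [RHS]addnA -pjE; lia.
rewrite sum_rotation /h big_split /= exchange_big /= lerD2l.
have B_ge0 : 0 <= B by exact: le_trans (g_ge0 x) (gleB x).
have := @avg_close R H W (fun i => if (i + W <= M)%N then 0 else B) (fun=> 0) B.
rewrite avg_cst subr0 => close.
have : `|avg H (fun i => if (i + W <= M)%N then 0 else B)| <= B * W%:R / 3 ^+ H.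
  apply: close => i; first by rewrite subr0; case: ifP; rewrite ?normr0// ger0_norm.
  by move=> iM; rewrite ltnW.
by move=> /(le_trans (ler_norm _)); rewrite /avg mulrC ler_pM2r.
Qed.

(** By invariance [g] and its average along an orbit piece of length $3^H$ have the same integral,
    and the latter is bounded at every point of the subshift. *)
Lemma integral_le_fixpt_avg g W B H : measurable_fun setT g ->
  (forall y, 0 <= g y <= B) -> depends_on W g ->
  (\int[mu]_x (g x)%:E <=
   (\sum_b avg H (fun i => g (fixpt_point b i)) + B * W%:R / 3 ^+ H)%:E)%E.
Proof.
move=> mg gB Wg; set M := (X in (_ <= X%:E)%E).
have g_ge0 y : 0 <= g y by have /andP[] := gB y.
pose G x := avg H (fun j => g (shift j%:Z x)).
have mgs j : measurable_fun setT (fun x : borel_shift => g (shift j x)).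
  exact: measurable_fun_shift.
have GM : (\int[mu]_x (G x)%:E <= M%:E)%E.
  apply: (integral_subshift_le mu_inv).
  - by apply: measurable_funM => //; exact: measurable_sum.
  - by move=> x; rewrite mulr_ge0 ?sumr_ge0// invr_ge0 ltW// expr3_gt0.
  - move=> x Xx; rewrite /M /G /avg.
    have := orbit_sum_le H Xx gB Wg.
    rewrite -(@ler_pM2l _ (3 ^+ H)^-1) ?invr_gt0 ?expr3_gt0//.
    by rewrite mulrDr [X in _ <= X + _]mulr_sumr [X in _ <= _ + X]mulrC.
apply: le_trans GM; rewrite /G /avg.
under [X in (_ <= X)%E]eq_integral do rewrite EFinM -sumEFin.
have mE j : measurable_fun setT (EFin \o (fun x : borel_shift => g (shift j x))).
  exact/measurable_EFinP.
rewrite ge0_integralZl//; last 2 first.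
- by apply: emeasurable_sum => j; exact: mE.
- by move=> x _; apply: sume_ge0 => j _; rewrite lee_fin.
rewrite ge0_integral_sum//; last 2 first.
- by move=> j; exact: (mE j).
- by move=> j x _; rewrite lee_fin.
have gI j : (\int[mu]_x (g (shift (Posz j) x))%:E = \int[mu]_x (g x)%:E)%E.
  by rewrite (ge0_integral_shift mu_inv j (f := EFin \o g))//; exact/measurable_EFinP.
under eq_bigr do rewrite gI.
have fin_I : (\int[mu]_x (g x)%:E)%E \is a fin_num.
  rewrite ge0_fin_numE; last by apply: integral_ge0 => x _; rewrite lee_fin.
  apply: (@le_lt_trans _ _ B%:E); last exact: ltry.
  by apply: (integral_subshift_le mu_inv) => // x _; have /andP[] := gB x.
rewrite -(fineK fin_I) sumEFin sumr_const_nat subn0 -EFinM.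
by rewrite -[_ *+ (3 ^ H)]mulr_natl natrX mulrA mulVf ?mul1r// gt_eqF// expr3_gt0.
Qed.

Lemma integral_le_fixpt_limsup g W B M : measurable_fun setT g ->
  (forall y, 0 <= g y <= B) -> depends_on W g ->
  (forall b, limsup_le (fun H => avg H (fun i => g (fixpt_point b i))) M) ->
  (\int[mu]_x (g x)%:E <= (3 * M)%:E)%E.
Proof.
move=> mg gB Wg hM.
have B_ge0 : 0 <= B by have /andP[? ?] := gB point; lra.
have lim : limsup_le (fun H => \sum_b avg H (fun i => g (fixpt_point b i)) +
    B * W%:R * (2 / 3) ^+ H) (\sum_(b : letter) M + 0).
  apply: limsup_leD; first by apply: limsup_le_sum => b; exact: hM.
  exact: cvg_limsup_le (geometric_cvg0 _).
apply/lee_addgt0Pr => e e0.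
have [H _ /(_ H (leqnn H)) hH] := lim _ e0.
apply: le_trans (integral_le_fixpt_avg H mg gB Wg) _.
rewrite -EFinD lee_fin; apply: le_trans (_ : _ <= \sum_(b : letter) M + 0 + e) _.
  by apply: le_trans hH; rewrite lerD2l ler_wpM2l ?expr3V_le// mulr_ge0.
by rewrite sum_letters lerD2r; lra.
Qed.

Section Annihilated.
Variables (k : nat) (alpha C : R).
Hypothesis C_ge0 : 0 <= C.
Hypothesis alphaP : forall n a b,
  `|coincidence R k n a b - (if a == b then alpha else (1 - alpha) / 2)|
  <= C * (2 / 3) ^+ n.

(** One parameter drives the dilation, the spacing of the exponents and their number, so the
    boundary, mixing and diagonal errors vanish together. *)
Definition annihilating_seq n := trig_dilate (3 ^ n) (annihilator k alpha n n).

Lemma weight_annihilating_seq n :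
  weight (annihilating_seq n) = 2 * (`|3 / 2 * (alpha - 3^-1)| + 1).
Proof. by rewrite weight_dilate weight_annihilator. Qed.

Lemma shift_op_fixpt_point l W f b i : depends_on W f ->
  shift_op l f (fixpt_point b i) = nat_op l (fun i => f (fixpt_point b i)) i.
Proof.
move=> Wf; apply: eq_bigr => p _; congr (_ * _); apply: Wf => j jW.
by rewrite /fixpt_point /shift -PoszD /= [(j + _)%N]addnC addnA.
Qed.

Lemma cylinder_annihilated f : cylinder_fun f -> exists K : R,
  forall n, (sqnorm mu (shift_op (annihilating_seq n) f) <=
    (K * (n.+1%:R^-1 + (2 / 3) ^+ n))%:E)%E.
Proof.
move=> cf; have [L [Lf [B fB]]] := cf.
have B_ge0 : 0 <= B by exact: le_trans (normr_ge0 _) (fB point).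
have mf := cylinder_fun_measurable cf.
(* Translation by [L] moves the window of [f] to nonnegative coordinates, where [fixpt_point] is
   meaningful. It commutes with [shift_op] and preserves the norm. *)
pose f' x := f (shift L%:Z x); pose W := (2 * L + 1)%N.
have Wf' : depends_on W f'.
  move=> x y xy; apply: Lf; apply/central_eqP => i iL; rewrite /shift.
  have -> : i + L%:Z = (absz (i + L%:Z))%:Z by lia.
  by apply: xy; rewrite /W; lia.
have mf' : measurable_fun setT f' by exact: measurable_fun_shift.
pose D := C + k%:R + C * `|alpha - (1 - alpha) / 2|.
have D_ge0 : 0 <= D by exact: mixing_const_ge0.
pose Wt := 2 * (`|3 / 2 * (alpha - 3^-1)| + 1).
have Wt_ge0 : 0 <= Wt by rewrite mulr_ge0// addr_ge0.
exists (3 * (12 * B ^+ 2 * (1 + D) + (Wt * B) ^+ 2 * W%:R)) => n.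
set P := annihilating_seq n.
have shiftE : sqnorm mu (shift_op P f) = sqnorm mu (shift_op P f').
  rewrite /sqnorm -(ge0_integral_shift mu_inv L (f := fun x => (shift_op P f x ^+ 2)%:E)).
  - apply: eq_integral => x _; congr (_ ^+ 2)%:E; apply: eq_bigr => p _.
    by rewrite /f' !shift_shift addrC.
  - by apply: measurable_sqr; exact: measurable_shift_op.
  - by move=> x; rewrite lee_fin sqr_ge0.
rewrite shiftE.
pose g x := shift_op P f' x ^+ 2.
have [W' W'P] := depends_on_shift_op P Wf'.
have gB y : 0 <= g y <= (weight P * B) ^+ 2.
  rewrite sqr_ge0 /g -[leLHS]real_normK ?num_real// lerXn2r ?nnegrE//.
    by rewrite mulr_ge0 ?weight_ge0.
  rewrite (le_trans (ler_norm_sum _ _ _))// mulr_suml.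
  by apply: ler_sum => p _; rewrite normrM ler_wpM2l// fB.
have mg : measurable_fun setT g by apply: measurable_funX; exact: measurable_shift_op.
have Wg : depends_on W' g by move=> x y xy; rewrite /g (W'P x y xy).
pose M := 12 * B ^+ 2 * (n.+1%:R^-1 + D * (2 / 3) ^+ n) + (Wt * B) ^+ 2 * W%:R / 3 ^+ n.
apply: le_trans (integral_le_fixpt_limsup (M := M) mg gB Wg _) _.
  move=> b; have := @local_function_limsup R k alpha C C_ge0 alphaP
    (fun b i => f' (fixpt_point b i)) W B b n n n.
  rewrite -/D -/Wt -/M => lim; apply: eq_limsup_le (lim _ _).
  - by move=> H; apply: eq_avg => i; rewrite /g (shift_op_fixpt_point _ _ _ Wf').
  - by move=> c i; exact: fB.
  - move=> m c q r rW; apply: Wf' => j jW; rewrite /fixpt_point /=.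
    by rewrite -addnA fixpt_block//; lia.
rewrite lee_fin -mulrA ler_pM2l// /M.
have zy := @expr3V_le R n; have y0 := @expr23_ge0 R n.
have w0 : 0 <= n.+1%:R^-1 :> R by rewrite invr_ge0.
have u0 : 0 <= 12 * B ^+ 2 by rewrite mulr_ge0// sqr_ge0.
have v0 : 0 <= (Wt * B) ^+ 2 * W%:R by rewrite mulr_ge0// sqr_ge0.
have := ler_wpM2l v0 zy; have := mulr_ge0 v0 w0; have := mulr_ge0 u0 y0.
have := mulr_ge0 (mulr_ge0 u0 D_ge0) w0.
move: (12 * _) ((_ ^+ 2) * _) (n.+1%:R^-1) ((2 / 3) ^+ n) (3 ^- n) => u v w y z.
lra.
Qed.

(** The weight of [annihilating_seq n] does not depend on [n], so these operators are uniformly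
    bounded and convergence on the dense cylinder functions extends to $L^2$. *)
Lemma annihilated F : measurable_fun setT F -> (sqnorm mu F < +oo)%E ->
  forall e : R, 0 < e ->
  \forall n \near \oo, (sqnorm mu (shift_op (annihilating_seq n) F) <= e%:E)%E.
Proof.
move=> mF F2 e e0; pose Wt := 2 * (`|3 / 2 * (alpha - 3^-1)| + 1).
have Wt_gt0 : 0 < Wt by rewrite mulr_gt0// ltr_wpDl.
have [_ /(_ (e / 4 / Wt ^+ 2))] := sqnorm_approx mF F2.
rewrite !divr_gt0 ?exprn_gt0// => /(_ isT)[f [cf Ff]].
have mf := cylinder_fun_measurable cf.
have [K hK] := cylinder_annihilated cf.
have lim : (fun n => K * (n.+1%:R^-1 + (2 / 3) ^+ n)) @ \oo --> (0 : R).
  rewrite -[X in _ --> X](mulr0 K); apply: cvgM; first exact: cvg_cst.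
  rewrite -[X in _ --> X](addr0 0); apply: cvgD; first exact: cvg_harmonic.
  by have := @geometric_cvg0 R 1; under eq_fun do rewrite mul1r.
near=> n.
rewrite (_ : shift_op _ F = fun x => shift_op (annihilating_seq n) f x +
    shift_op (annihilating_seq n) (fun x => F x - f x) x); last first.
  apply/funext => x; rewrite /shift_op -big_split /=; apply: eq_bigr => p _.
  by rewrite -mulrDr addrC subrK.
apply: sqnormD_le_quarter; [exact: measurable_shift_op| | |].
- by apply: measurable_shift_op; exact: measurable_funB.
- apply: le_trans (hK n) _; rewrite lee_fin.
  by near: n; apply: (cvgr_le _ lim); rewrite divr_gt0.
- apply: le_trans (sqnorm_shift_op mu_inv _ _) _; first exact: measurable_funB.
  rewrite weight_annihilating_seq -/Wt.
  apply: le_trans (lee_wpmul2l _ Ff) _; first by rewrite lee_fin sqr_ge0.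
  rewrite -EFinM lee_fin mulrC divfK// gt_eqF// exprn_gt0//.
Unshelve. all: by end_near. Qed.

End Annihilated.

End OrbitAverage.

(** * Trigonometric polynomials on the circle *)

Section TrigEvaluation.
Variable R : realType.
Implicit Types (l : seq (R * nat)) (u v w : R[i]).
Local Notation Re := (@complex.Re R).
Local Notation Im := (@complex.Im R).

Definition sqmod u : R := Re u ^+ 2 + Im u ^+ 2.

Lemma sqmod_ge0 u : 0 <= sqmod u.
Proof. by rewrite addr_ge0// sqr_ge0. Qed.

Lemma ReM u v : Re (u * v) = Re u * Re v - Im u * Im v.
Proof. by case: u v => a b [c d]. Qed.

Lemma ImM u v : Im (u * v) = Re u * Im v + Im u * Re v.
Proof. by case: u v => a b [c d]. Qed.

Lemma ReD u v : Re (u + v) = Re u + Re v.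
Proof. by case: u v => a b [c d]. Qed.

Lemma ImD u v : Im (u + v) = Im u + Im v.
Proof. by case: u v => a b [c d]. Qed.

Lemma sqmodM u v : sqmod (u * v) = sqmod u * sqmod v.
Proof. by rewrite /sqmod ReM ImM; ring. Qed.

Lemma sqmodX w k : sqmod w = 1 -> sqmod (w ^+ k) = 1.
Proof.
move=> w1; elim: k => [|k IH]; last by rewrite exprS sqmodM w1 IH mul1r.
by rewrite expr0 /sqmod /= expr0n addr0 expr1n.
Qed.

Lemma sqmod_circle (z : circle_set R) : sqmod (val z) = 1.
Proof.
have /eqP := valP z; rewrite normc_def => /(congr1 Re) /= s1.
rewrite -[LHS]sqr_sqrtr; last exact: sqmod_ge0.
by rewrite /sqmod s1 expr1n.
Qed.

Definition trig_eval l w : R[i] := \sum_(p <- l) (p.1)%:C%C * w ^+ p.2.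

Lemma trig_eval_mul l1 l2 w :
  trig_eval (trig_mul l1 l2) w = trig_eval l1 w * trig_eval l2 w.
Proof.
rewrite /trig_eval big_allpairs_dep mulr_suml; apply: eq_bigr => p _.
rewrite mulr_sumr; apply: eq_bigr => p' _.
by rewrite rmorphM exprD /= mulrACA.
Qed.

Lemma trig_eval_dilate d l w : trig_eval (trig_dilate d l) w = trig_eval l (w ^+ d).
Proof.
by rewrite /trig_eval big_map; apply: eq_bigr => p _; rewrite exprM.
Qed.

Lemma trig_eval_sub l b w : trig_eval (trig_sub l b) w = trig_eval l w - b%:C%C.
Proof. by rewrite /trig_eval big_cons /= expr0 mulr1 rmorphN addrC. Qed.

Lemma Re_trig_eval l w : Re (trig_eval l w) = \sum_(p <- l) p.1 * Re (w ^+ p.2).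
Proof.
elim: l => [|p l IH]; first by rewrite /trig_eval !big_nil.
by rewrite /trig_eval !big_cons ReD IH ReM /= mul0r subr0.
Qed.

Lemma Im_trig_eval l w : Im (trig_eval l w) = \sum_(p <- l) p.1 * Im (w ^+ p.2).
Proof.
elim: l => [|p l IH]; first by rewrite /trig_eval !big_nil.
by rewrite /trig_eval !big_cons ImD IH ImM /= mul0r addr0.
Qed.

(** Both subtractions are truncated and one of them is 0, so this is $|i-j|$. *)
Definition distn_nat (i j : nat) : nat := (i - j) + (j - i).

(** Both sides are the real part of $w^i\overline{w^j}$. *)
Lemma Re_expr_dist w i j : sqmod w = 1 ->
  Re (w ^+ i) * Re (w ^+ j) + Im (w ^+ i) * Im (w ^+ j) = Re (w ^+ distn_nat i j).
Proof.
move=> w1; wlog ji : i j / (j <= i)%N => [W|].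
  have [/W//|/ltnW/W] := leqP j i.
  by rewrite /distn_nat addnC => <-; ring.
rewrite /distn_nat (eqP ji) addn0 -{1 2}(subnK ji) exprD ReM ImM.
have := sqmodX j w1; rewrite /sqmod.
move: (Re (w ^+ j)) (Im (w ^+ j)) (Re _) (Im _) => c d a b cd1.
by rewrite -[RHS]mulr1 -cd1; ring.
Qed.

Lemma sqmod_trig_eval l w : sqmod w = 1 -> sqmod (trig_eval l w) =
  \sum_(p <- l) \sum_(p' <- l) p.1 * p'.1 * Re (w ^+ distn_nat p.2 p'.2).
Proof.
move=> w1; rewrite /sqmod Re_trig_eval Im_trig_eval !expr2 !mulr_suml -big_split.
apply: eq_bigr => p _; rewrite !mulr_sumr -big_split; apply: eq_bigr => p' _ /=.
by rewrite -(Re_expr_dist _ _ w1); ring.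
Qed.

Lemma sqmod_sub_ge u b : sqmod u <= b ^+ 2 / 4 -> b ^+ 2 / 4 <= sqmod (u - b%:C%C).
Proof.
case: u => x y; rewrite /sqmod /= => xy.
rewrite subr0; have := sqr_ge0 (2 * x - b); have := sqr_ge0 y; nra.
Qed.

(** For $c \ne 0$, $u$ and $(u-1)(u-c)$ cannot both be small. If $|u|$ is at most half of both 1 and
    $|c|$, then $|u-1| \ge 1/2$ and $|u-c| \ge |c|/2$; otherwise the first term alone is large
    enough. *)
Lemma sqmod_annihilator_lower u c : 1 / 4 * (c ^+ 2 / 4) <=
  (c ^+ 2 + 1) ^+ 2 * sqmod u + sqmod ((u - 1%:C%C) * (u - c%:C%C)).
Proof.
rewrite sqmodM; have u0 := sqmod_ge0 u.
have p1 := sqmod_ge0 (u - 1%:C%C); have pc := sqmod_ge0 (u - c%:C%C).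
have [u1|u1] := leP (sqmod u) (1 ^+ 2 / 4); last first.
  apply: ler_wpDr; first exact: mulr_ge0.
  move: u1 (sqr_ge0 c) u0; rewrite expr1n; move: (c ^+ 2) (sqmod u) => q t ? q0 ?.
  have := ler_wpM2l (sqr_ge0 (q + 1)) (_ : 1 / 4 <= t); rewrite ltW// => /(_ isT).
  by have := sqr_ge0 q; nra.
have [uc|uc] := leP (sqmod u) (c ^+ 2 / 4); last first.
  apply: ler_wpDr; first exact: mulr_ge0.
  move: uc (sqr_ge0 c) u0; move: (c ^+ 2) (sqmod u) => q t ? q0 t0.
  by have := mulr_ge0 (mulr_ge0 q0 q0) t0; have := mulr_ge0 q0 t0; nra.
apply: ler_wpDl; first by rewrite mulr_ge0// sqr_ge0.
apply: ler_pM => //; first by rewrite divr_ge0// sqr_ge0.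
  by have := sqmod_sub_ge u1; rewrite expr1n.
exact: sqmod_sub_ge.
Qed.

Lemma measurable_circle_coord :
  measurable_fun setT (@circle_coord R : circle R -> (R * R)%type).
Proof. by move=> _ B mB; exists B. Qed.

Lemma measurable_circle_expr k :
  measurable_fun setT (fun z : circle R => Re (val z ^+ k)) /\
  measurable_fun setT (fun z : circle R => Im (val z ^+ k)).
Proof.
have mRe : measurable_fun setT (fun z : circle R => Re (val z)).
  exact: measurableT_comp measurable_fst measurable_circle_coord.
have mIm : measurable_fun setT (fun z : circle R => Im (val z)).
  exact: measurableT_comp measurable_snd measurable_circle_coord.
elim: k => [|k [mR mI]]; first by split; exact: measurable_cst.
split.
  rewrite (_ : (fun _ => _) = fun z : circle R =>
      Re (val z) * Re (val z ^+ k) - Im (val z) * Im (val z ^+ k)).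
    by apply: measurable_funB; exact: measurable_funM.
  by apply/funext => z; rewrite exprS ReM.
rewrite (_ : (fun _ => _) = fun z : circle R =>
    Re (val z) * Im (val z ^+ k) + Im (val z) * Re (val z ^+ k)).
  by apply: measurable_funD; exact: measurable_funM.
by apply/funext => z; rewrite exprS ImM.
Qed.

Lemma measurable_sqmod_trig_eval l :
  measurable_fun setT (fun z : circle R => sqmod (trig_eval l (val z))).
Proof.
apply: measurable_funD; apply: measurable_funX.
- rewrite (_ : (fun _ => _) = fun z : circle R => \sum_(p <- l) p.1 * Re (val z ^+ p.2)).
    apply: measurable_sum => p; apply: measurable_funM => //.
    by have [] := measurable_circle_expr p.2.
  by apply/funext => z; rewrite Re_trig_eval.
- rewrite (_ : (fun _ => _) = fun z : circle R => \sum_(p <- l) p.1 * Im (val z ^+ p.2)).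
    apply: measurable_sum => p; apply: measurable_funM => //.
    by have [] := measurable_circle_expr p.2.
  by apply/funext => z; rewrite Im_trig_eval.
Qed.

Lemma Re_circle_norm (z : circle_set R) k : `|Re (val z ^+ k)| <= 1.
Proof.
have := sqmodX k (sqmod_circle z); rewrite /sqmod => E.
rewrite -(@ler_pXn2r _ 2)// ?nnegrE// expr1n -normrX ger0_norm ?sqr_ge0//.
by rewrite -E lerDl sqr_ge0.
Qed.

End TrigEvaluation.

(** * Null sets from summable integrals *)

Section SummableNull.
Context d (T : measurableType d) (R : realType) (m : {measure set T -> \bar R}).
Variables (D : set T) (mD : measurable D) (f : nat -> T -> R).
Hypothesis mf : forall j, measurable_fun setT (f j).
Hypothesis f_ge0 : forall j x, 0 <= f j x.

Definition esum_seq x : \bar R := (\sum_(0 <= j <oo) (f j x)%:E)%E.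

Lemma measurable_esum_seq : measurable_fun setT esum_seq.
Proof.
apply: (@ge0_emeasurable_sum _ _ _ setT (fun j x => (f j x)%:E) xpredT).
- by move=> j x _ _; rewrite lee_fin.
- by move=> j _; exact/measurable_EFinP.
Qed.

Lemma measurable_esum_seq_infty : measurable (esum_seq @^-1` [set +oo%E]).
Proof.
rewrite -[X in measurable X]setTI.
by apply: measurable_esum_seq => //; exact: emeasurable_set1.
Qed.

(** The series has integral at most $\sum_j 2^{-j-1} = 1$ over [D], hence is finite almost
    everywhere there. *)
Lemma summable_null :
  (forall j, (\int[m]_(x in D) (f j x)%:E <= (1 / (2 ^ j.+1)%:R)%:E)%E) ->
  m (D `&` esum_seq @^-1` [set +oo%E]) = 0%E.
Proof.
move=> fle.
have mfD j : measurable_fun D (EFin \o f j).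
  by apply/measurable_EFinP; exact: measurable_funS (mf j).
have int_le : (\int[m]_(x in D) esum_seq x <= 1%:E)%E.
  rewrite integral_nneseries//; last by move=> j x _; rewrite lee_fin.
  apply: le_trans (epsilon_trick0 xpredT ler01).
  apply: lee_nneseries => j; first by move=> _ _; apply: integral_ge0 => x _; rewrite lee_fin.
  by move=> _; exact: fle.
have mh : measurable_fun D esum_seq by exact: measurable_funS measurable_esum_seq.
have h_ge0 x : (0 <= esum_seq x)%E by apply: nneseries_ge0 => j _ _; rewrite lee_fin.
have int_h : m.-integrable D esum_seq.
  apply/integrableP; split=> //.
  under eq_integral do rewrite gee0_abs//.
  by rewrite (le_lt_trans int_le)// ltry.
have [N [mN N0 sub]] := integrable_ae mD int_h.
apply: (subset_measure0 _ mN _ N0).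
  by apply: measurableI => //; exact: measurable_esum_seq_infty.
by move=> x [Dx /= hx]; apply: sub => /= /(_ Dx); rewrite hx.
Qed.

Lemma esum_seq_fin_bound x : esum_seq x <> +oo%E ->
  exists M : R, forall J, \sum_(0 <= j < J) f j x <= M.
Proof.
move=> h; exists (fine (esum_seq x)) => J.
have h_ge0 : (0 <= esum_seq x)%E by apply: nneseries_ge0 => j _ _; rewrite lee_fin.
rewrite -lee_fin fineK; last first.
  by rewrite ge0_fin_numE// ltey; exact/eqP.
rewrite -sumEFin; apply: nneseries_lim_ge => j _ _.
by rewrite lee_fin.
Qed.

End SummableNull.

Section DoubleSum.
Context d (T : measurableType d) (R : realType) (m : {measure set T -> \bar R}).
Variables (D : set T) (mD : measurable D).

(** Expands the integral of a squared polynomial; shared by the spectral measure, the invariant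
    measure and Lebesgue measure. *)
Lemma integral_double_sum (l : seq (R * nat)) (G : nat -> nat -> T -> R)
    (rho : nat -> nat -> R) :
  (forall i j, m.-integrable D (EFin \o G i j)) ->
  (forall i j, \int[m]_(x in D) (G i j x)%:E = (rho i j)%:E)%E ->
  (\int[m]_(x in D) (\sum_(p <- l) \sum_(p' <- l) p.1 * p'.1 * G p.2 p'.2 x)%:E)%E =
  (\sum_(p <- l) \sum_(p' <- l) p.1 * p'.1 * rho p.2 p'.2)%:E.
Proof.
move=> intG intE.
have iZ (p p' : R * nat) :
    m.-integrable D (fun x => ((p.1 * p'.1)%:E * (G p.2 p'.2 x)%:E)%E).
  by apply: integrableZl => //; exact: intG.
transitivity (\int[m]_(x in D) (\sum_(p <- l) \sum_(p' <- l)
    (p.1 * p'.1)%:E * (G p.2 p'.2 x)%:E))%E.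
  apply: eq_integral => x _; rewrite -sumEFin; apply: eq_bigr => p _.
  by rewrite -sumEFin; apply: eq_bigr => p' _; rewrite EFinM.
rewrite integral_sum//; last by move=> p; exact: integrable_sum.
rewrite -sumEFin; apply: eq_bigr => p _.
rewrite integral_sum// -sumEFin; apply: eq_bigr => p' _.
by rewrite [RHS]EFinM -intE -integralZl//; exact: intG.
Qed.

End DoubleSum.

(** * Transfer from $L^2(\mu)$ to the spectral measure *)

Section SpectralIdentity.
Variables (R : realType) (mu : probability borel_shift R).
Hypothesis mu_inv : invariant_on (subshift zeta) mu.
Variables (F : borel_shift -> R[i]) (sigma : {finite_measure set (circle R) -> \bar R}).
Hypothesis F_L2 : square_integrable mu F.
Hypothesis F_sigma : is_spectral_measure mu F sigma.

Let F1 x := complex.Re (F x).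
Let F2 x := complex.Im (F x).

Let mF1 : measurable_fun setT F1. Proof. by have [] := F_L2. Qed.
Let mF2 : measurable_fun setT F2. Proof. by have [] := F_L2. Qed.

Lemma sqnorm_Re_lt : (sqnorm mu F1 < +oo)%E.
Proof.
have [_ _] := F_L2; apply: le_lt_trans; apply: ge0_le_integral => //.
- by move=> x _; rewrite lee_fin sqr_ge0.
- exact: measurable_sqr.
- apply/measurable_EFinP; apply: measurable_funD; exact: measurable_funX.
- by move=> x _; rewrite lee_fin lerDl sqr_ge0.
Qed.

Lemma sqnorm_Im_lt : (sqnorm mu F2 < +oo)%E.
Proof.
have [_ _] := F_L2; apply: le_lt_trans; apply: ge0_le_integral => //.
- by move=> x _; rewrite lee_fin sqr_ge0.
- exact: measurable_sqr.
- apply/measurable_EFinP; apply: measurable_funD; exact: measurable_funX.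
- by move=> x _; rewrite lee_fin lerDr sqr_ge0.
Qed.

Lemma integral_shift (k : nat) (f : borel_shift -> \bar R) :
  measurable_fun setT f ->
  (\int[mu]_x f (shift k%:Z x) = \int[mu]_x f x)%E.
Proof.
move=> mf; rewrite integralE [RHS]integralE; congr (_ - _)%E.
- rewrite -[RHS](ge0_integral_shift mu_inv k (measurable_funepos mf) (funepos_ge0 f)).
  by apply: eq_integral => x _; rewrite !funeposE.
- rewrite -[RHS](ge0_integral_shift mu_inv k (measurable_funeneg mf) (funeneg_ge0 f)).
  by apply: eq_integral => x _; rewrite !funenegE.
Qed.

(** The real part of $F(T^ix)\overline{F(T^jx)}$. *)
Let corr (i j : nat) (x : borel_shift) : R := F1 (shift i%:Z x) * F1 (shift j%:Z x) +
  F2 (shift i%:Z x) * F2 (shift j%:Z x).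

Let measurable_corr i j : measurable_fun setT (corr i j).
Proof.
by apply: measurable_funD; apply: measurable_funM; exact: measurable_fun_shift.
Qed.

Lemma integrable_sqr_shift (f : borel_shift -> R) (k : nat) :
  measurable_fun setT f -> (sqnorm mu f < +oo)%E ->
  mu.-integrable setT (fun x => (f (shift k%:Z x) ^+ 2)%:E).
Proof.
move=> mf f2; apply/integrableP; split.
  by apply: measurable_sqr; exact: measurable_fun_shift.
under eq_integral do rewrite gee0_abs ?lee_fin ?sqr_ge0//.
by rewrite (ge0_integral_shift mu_inv k (measurable_sqr mf))// => x; rewrite lee_fin sqr_ge0.
Qed.

Lemma integrable_corr i j : mu.-integrable setT (EFin \o corr i j).
Proof.
have int_bound : mu.-integrable setT (fun x =>
    (((F1 (shift i%:Z x) ^+ 2)%:E + (F1 (shift j%:Z x) ^+ 2)%:E) +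
    ((F2 (shift i%:Z x) ^+ 2)%:E + (F2 (shift j%:Z x) ^+ 2)%:E))%E).
  apply: integrableD => //; apply: integrableD => //;
    apply: integrable_sqr_shift => //; [exact: sqnorm_Re_lt..|exact: sqnorm_Im_lt|exact: sqnorm_Im_lt].
apply: (le_integrable _ _ _ int_bound) => //.
  exact/measurable_EFinP.
move=> x _ /=; rewrite lee_fin /corr.
move: (F1 _) (F1 _) (F2 _) (F2 _) => a b c e.
rewrite [leRHS]ger0_norm ?addr_ge0 ?sqr_ge0// ler_norml.
have := sqr_ge0 (a + b); have := sqr_ge0 (a - b).
have := sqr_ge0 (c + e); have := sqr_ge0 (c - e).
have := sqr_ge0 a; have := sqr_ge0 b; have := sqr_ge0 c; have := sqr_ge0 e.
by move=> *; apply/andP; split; nra.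
Qed.

Let rho n : R := Rintegral sigma setT (fun z => complex.Re (val z ^+ n)).

Lemma integrable_Re_expr n :
  sigma.-integrable setT (fun z : circle R => (complex.Re (val z ^+ n))%:E).
Proof.
apply: (@measurable_bounded_integrable _ _ _ sigma
  (fun z : circle R => complex.Re (val z ^+ n))) => //.
- by rewrite -ge0_fin_numE// fin_num_measure.
- by have [] := @measurable_circle_expr R n.
- exists 1; split=> // M M1 z _ /=.
  by rewrite (le_trans (Re_circle_norm _ _))// ltW.
Qed.

Lemma integral_Re_expr n :
  (\int[sigma]_z (complex.Re (val z ^+ n))%:E = (rho n)%:E)%E.
Proof.
by rewrite /rho /Rintegral fineK//; apply: integrable_fin_num => //; exact: integrable_Re_expr.
Qed.

Lemma integral_corr0 n : (\int[mu]_x (corr n 0 x)%:E = (rho n)%:E)%E.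
Proof.
(* The defining relation is taken at $k = -n$, where the character is $z^n$ and [F] is moved by the
   forward shift $T^n$. *)
have := congr1 (@complex.Re R) (F_sigma (- n%:Z)); rewrite /= opprK => E.
rewrite /rho.
have -> : (fun z : circle R => complex.Re (val z ^+ n)) =
  (fun z => complex.Re (val z ^ n%:Z)) by [].
rewrite {}E /Rintegral fineK; last first.
  rewrite (_ : (fun _ => _) = EFin \o corr n 0); last first.
    apply/funext => x; congr EFin; rewrite /corr shift0 /F1 /F2 ReM.
    by case: (F x) => a b /=; rewrite mulrN opprK.
  by apply: integrable_fin_num => //; exact: integrable_corr.
apply: eq_integral => x _; congr EFin; rewrite /corr shift0 /F1 /F2 ReM.
by case: (F x) => a b /=; rewrite mulrN opprK.
Qed.

Lemma integral_corr i j : (\int[mu]_x (corr i j x)%:E = (rho (distn_nat i j))%:E)%E.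
Proof.
wlog ji : i j / (j <= i)%N => [W|].
  have [/W//|/ltnW/W] := leqP j i.
  rewrite /distn_nat addnC => <-; apply: eq_integral => x _; congr EFin.
  by rewrite /corr; congr (_ + _); rewrite mulrC.
rewrite /distn_nat (eqP ji) addn0 -integral_corr0.
rewrite -(integral_shift j (f := EFin \o corr (i - j) 0)); last exact/measurable_EFinP.
apply: eq_integral => x _; congr EFin.
by rewrite /corr !shift_shift -PoszD subnK// add0r.
Qed.

(** The coefficients are real, so only real parts of correlations enter and the real and imaginary
    parts of [F] contribute separately. This lets the real-valued estimates apply to complex [F]. *)
Lemma spectral_identity l :
  (\int[sigma]_z (sqmod (trig_eval l (val z)))%:E =
   sqnorm mu (shift_op l F1) + sqnorm mu (shift_op l F2))%E.
Proof.
have m1 := measurable_shift_op l mF1; have m2 := measurable_shift_op l mF2.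
rewrite -ge0_integralD//; last 4 first.
- by move=> x _; rewrite lee_fin sqr_ge0.
- exact: measurable_sqr.
- by move=> x _; rewrite lee_fin sqr_ge0.
- exact: measurable_sqr.
transitivity (\sum_(p <- l) \sum_(p' <- l) p.1 * p'.1 * rho (distn_nat p.2 p'.2))%:E.
  rewrite -(integral_double_sum (measurableT) l
    (G := fun i j z => complex.Re (val z ^+ distn_nat i j)) (m := sigma)
    (rho := fun i j => rho (distn_nat i j))).
  - by apply: eq_integral => z _; rewrite (sqmod_trig_eval _ (sqmod_circle z)).
  - by move=> i j; exact: integrable_Re_expr.
  - by move=> i j; exact: integral_Re_expr.
rewrite -(integral_double_sum (measurableT) l (G := corr) (m := mu)
  (rho := fun i j => rho (distn_nat i j))).
- apply: eq_integral => x _; rewrite -EFinD; congr EFin.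
  rewrite /shift_op !expr2 !mulr_suml -big_split; apply: eq_bigr => p _.
  rewrite !mulr_sumr -big_split; apply: eq_bigr => p' _ /=.
  by rewrite /corr; ring.
- exact: integrable_corr.
- exact: integral_corr.
Qed.

End SpectralIdentity.

(** * Orthogonality of characters on the circle *)

Section LebesgueCircle.
Variable R : realType.

Lemma expi_expr (t : R) n :
  val (expi t) ^+ n = (cos (n%:R * t) +i* sin (n%:R * t))%C.
Proof.
elim: n => [|n IH]; first by rewrite expr0 mul0r cos0 sin0.
rewrite exprS IH -[n.+1%:R]natr1 mulrDl mul1r addrC cosD sinD.
by apply/eqP; rewrite eq_complex /=; apply/andP; split; apply/eqP; ring.
Qed.

Lemma is_derive_sin_scale (a t : R) : a != 0 ->
  is_derive t (1 : R) (fun s : R => a^-1 * sin (a * s)) (cos (a * t)).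
Proof.
move=> a0.
have h1 : is_derive t (1 : R) (fun s : R => a * s) a.
  by have := is_deriveZ a (is_derive_id t (1 : R)); rewrite /GRing.scale /= mulr1.
have h2 := is_derive1_comp (is_derive_sin (a * t)) h1.
have h3 : is_derive t (1 : R) (fun s : R => a^-1 * sin (a * s)) (a^-1 *: (cos (a * t) * a)).
  exact: is_deriveZ h2.
by apply: (is_derive_eq h3); rewrite /GRing.scale /= mulrCA mulVf// mulr1.
Qed.

Lemma sin_2pi_nat n : sin (n%:R * (2 * pi)) = 0 :> R.
Proof.
have := expi_expr (2 * pi) n.
have -> : val (expi (2 * pi : R)) = 1.
  by rewrite /= mulr_natl cos2pi sin2pi.
by rewrite expr1n => /(congr1 (@complex.Im R)) /= <-.
Qed.

Lemma integral_cos n : (0 < n)%N ->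
  (\int[lebesgue_measure]_(t in `[0%R, 1%R]) (cos (n%:R * (2 * pi * t)))%:E = 0 :> \bar R)%E.
Proof.
move=> n0; pose a : R := n%:R * (2 * pi).
have a0 : a != 0.
  by rewrite mulf_neq0// ?pnatr_eq0 -?lt0n// mulf_neq0 ?pnatr_eq0// gt_eqF// pi_gt0.
have dF t := is_derive_sin_scale t a0.
have cF t : {for t, continuous (fun s : R => a^-1 * sin (a * s))}.
  apply: differentiable_continuous; apply/derivable1_diffP.
  by have [] := dF t.
transitivity (\int[lebesgue_measure]_(t in `[0%R, 1%R]) (cos (a * t))%:E)%E.
  by apply: eq_integral => t _; rewrite /a !mulrA.
rewrite (@continuous_FTC2 R (fun t => cos (a * t)) (fun s => a^-1 * sin (a * s)))//.
- by rewrite mulr1 mulr0 sin0 /a sin_2pi_nat !mulr0 subee.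
- apply: continuous_subspaceT => t; apply: continuous_comp; last exact: continuous_cos.
  exact: mulrl_continuous.
- split.
  + by move=> t _; have [] := dF t.
  + by apply: cvg_at_right_filter; exact: cF.
  + by apply: cvg_at_left_filter; exact: cF.
- by move=> t _; rewrite derive1E; have [] := dF t.
Qed.

Let m := @lebesgue_measure R.
Let I01 : set R := `[0, 1[%classic.

Lemma measure_itv01 : m I01 = 1%E.
Proof. by rewrite [LHS]lebesgue_measure_itv/= lte01 sube0. Qed.

Lemma measurable_expi : measurable_fun setT (fun t : R => expi (2 * pi * t) : circle R).
Proof.
move=> _ A [B mB <-]; rewrite !setTI.
have mc (f : R -> R) : continuous f -> measurable_fun setT (fun t : R => f (2 * pi * t)).
  move=> cf; apply: continuous_measurable_fun => t; apply: continuous_comp; last exact: cf.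
  exact: mulrl_continuous.
have mpair : measurable_fun setT (fun t : R => (cos (2 * pi * t), sin (2 * pi * t))).
  by apply: measurable_fun_pair; apply: mc; [exact: continuous_cos|exact: continuous_sin].
by rewrite -[X in measurable X]setTI; exact: (mpair measurableT B mB).
Qed.

Lemma integrable_cos01 n : m.-integrable I01 (fun t => (cos (n%:R * (2 * pi * t)))%:E).
Proof.
apply: (@measurable_bounded_integrable _ _ _ m (fun t => cos (n%:R * (2 * pi * t)))) => //.
- exact: measurable_itv.
- by rewrite [X in (X < _)%E]measure_itv01 ltry.
- apply: measurable_funS measurableT _ _ => //.
  have [mR _] := @measurable_circle_expr R n.
  have := measurableT_comp mR measurable_expi; apply: eq_measurable_fun => t _ /=.
  by rewrite -/(val (expi (2 * pi * t))) expi_expr.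
- exists 1; split=> // M M1 t _ /=.
  by rewrite (le_trans _ (ltW M1))// ler_norml cos_geN1 cos_le1.
Qed.

Lemma integral_cos01 n :
  (\int[m]_(t in I01) (cos (n%:R * (2 * pi * t)))%:E = (n == 0)%:R%:E)%E.
Proof.
have [->|n0] := posnP n.
  rewrite (eq_integral (cst 1%:E)) => [|t _]; last by rewrite mul0r cos0.
  rewrite integral_cst; last exact: measurable_itv.
  by rewrite [X in (_ * X)%E]measure_itv01 mule1.
(* The circle is parametrized by a half-open interval and the fundamental theorem of calculus uses
   the closed one; they differ by a null point. *)
rewrite /I01 integral_itv_bndo_bndc ?integral_cos//.
by have /integrableP[] := integrable_cos01 n.
Qed.

Lemma integral_sqmod_lebesgue l :
  (\int[m]_(t in I01) (sqmod (trig_eval l (val (expi (2 * pi * t)))))%:E =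
  (\sum_(p <- l) \sum_(p' <- l) p.1 * p'.1 * (p.2 == p'.2)%:R)%:E)%E.
Proof.
rewrite -(integral_double_sum (measurable_itv `[0, 1[) l (m := m)
  (G := fun i j t => cos ((distn_nat i j)%:R * (2 * pi * t)))
  (rho := fun i j => (i == j)%:R)).
- apply: eq_integral => t _; rewrite (sqmod_trig_eval _ (sqmod_circle _)).
  congr EFin; apply: eq_bigr => p _; apply: eq_bigr => p' _.
  by rewrite expi_expr.
- by move=> i j; exact: integrable_cos01.
- move=> i j; rewrite integral_cos01; congr (_ : bool)%:R%:E.
  by rewrite /distn_nat addn_eq0 !subn_eq0 -eqn_leq.
Qed.

(** Positivity of [k] and [n] makes the $n+1$ exponents distinct, so by orthogonality only $n+1$
    diagonal terms $(n+1)^{-2}$ survive. *)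
Lemma integral_sqmod_mean k n : (0 < k)%N -> (0 < n)%N ->
  (\int[m]_(t in I01) (sqmod (trig_eval (trig_dilate (3 ^ n) (trig_mean R k n n))
    (val (expi (2 * pi * t)))))%:E = (n.+1%:R^-1)%:E)%E.
Proof.
move=> k0 n0; rewrite integral_sqmod_lebesgue; congr EFin.
have [ms msE] : exists ms, ms = iota 0 n.+1 by eexists.
rewrite /trig_dilate /trig_mean -msE !big_map /=.
pose w : R := n.+1%:R^-1.
rewrite (eq_big_seq (fun=> w * w)) => [|i im].
  rewrite big_const_seq count_predT msE size_iota iter_addr addr0.
  by rewrite -[_ *+ _]mulr_natr -mulrA mulVf ?mulr1.
rewrite !big_map /= (eq_bigr (fun j => w * w * (j == i)%:R)) => [|j _].
  rewrite -mulr_sumr -natr_sum.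
  have -> : (\sum_(j <- ms) (j == i) = count_mem i ms)%N.
    by rewrite -sum1_count [RHS]big_mkcond /=; apply: eq_bigr.
  by rewrite count_uniq_mem msE ?iota_uniq// -msE im mulr1.
congr (_ * (_ : bool)%:R).
by rewrite eqn_pmul2l ?expn_gt0// eqn_pmul2l// eqn_exp2l// eqn_pmul2l// eq_sym.
Qed.

End LebesgueCircle.

(** * Singularity of spectral measures *)

Section Singular.
Variables (R : realType) (mu : probability borel_shift R).
Hypothesis mu_inv : invariant_on (subshift zeta) mu.

Lemma annihilating_subsequence (alpha C : R) (F1 F2 : borel_shift -> R) :
  0 <= C ->
  (forall n a b,
    `|coincidence R 2 n a b - (if a == b then alpha else (1 - alpha) / 2)|
    <= C * (2 / 3) ^+ n) ->
  measurable_fun setT F1 -> (sqnorm mu F1 < +oo)%E ->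
  measurable_fun setT F2 -> (sqnorm mu F2 < +oo)%E ->
  exists n_ : nat -> nat, forall j, [/\ (0 < n_ j)%N,
    (sqnorm mu (shift_op (annihilating_seq 2 alpha (n_ j)) F1) +
     sqnorm mu (shift_op (annihilating_seq 2 alpha (n_ j)) F2) <=
     (1 / (2 ^ j.+1)%:R)%:E)%E
    & (n_ j).+1%:R^-1 <= 1 / (2 ^ j.+1)%:R :> R].
Proof.
move=> C0 alphaP mF1 F1_lt mF2 F2_lt.
suff /choice[n_ n_P] : forall j, exists n, [/\ (0 < n)%N,
    (sqnorm mu (shift_op (annihilating_seq 2 alpha n) F1) +
     sqnorm mu (shift_op (annihilating_seq 2 alpha n) F2) <=
     (1 / (2 ^ j.+1)%:R)%:E)%E
    & n.+1%:R^-1 <= 1 / (2 ^ j.+1)%:R :> R] by exists n_.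
move=> j.
pose e : R := 1 / (2 ^ j.+1)%:R.
have e0 : 0 < e by rewrite divr_gt0// ltr0n expn_gt0.
have e20 : 0 < e / 2 by rewrite divr_gt0.
have [N _ NP] : \forall n \near \oo, [/\ (0 < n)%N,
    (sqnorm mu (shift_op (annihilating_seq 2 alpha n) F1) <= (e / 2)%:E)%E,
    (sqnorm mu (shift_op (annihilating_seq 2 alpha n) F2) <= (e / 2)%:E)%E
    & n.+1%:R^-1 <= e].
  near=> n; split.
  - by near: n; exists 1%N.
  - by near: n; exact: (annihilated mu_inv C0 alphaP mF1 F1_lt e20).
  - by near: n; exact: (annihilated mu_inv C0 alphaP mF2 F2_lt e20).
  - by near: n; exact: (cvgr_le _ (@cvg_harmonic R)).
have [? le1 le2 ?] := NP N (leqnn N).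
exists N; split=> //; rewrite -/e [e]splitr EFinD; exact: leeD.
Unshelve. all: by end_near. Qed.

Lemma spectral_measure_singular (F : borel_shift -> R[i])
    (sigma : {finite_measure set (circle R) -> \bar R}) :
  square_integrable mu F -> is_spectral_measure mu F sigma ->
  mutually_singular sigma (@lebesgue_circle R).
Proof.
move=> F_L2 F_sigma.
have [mF1 mF2 _] := F_L2.
have [alpha [C [C0 [alphaP /limit_neq_third alpha3]]]] := coincidence_limit R 2.
have [n_ n_P] := annihilating_subsequence C0 alphaP
  mF1 (sqnorm_Re_lt F_L2) mF2 (sqnorm_Im_lt F_L2).
pose c := 3 / 2 * (alpha - 3^-1).
have c2 : 0 < c ^+ 2.
  by rewrite exprn_even_gt0//= mulf_neq0 ?subr_eq0// gt_eqF// divr_gt0.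
pose V n := trig_dilate (3 ^ n) (trig_mean R 2 n n).
pose v j (z : circle R) := sqmod (trig_eval (V (n_ j)) (val z)).
pose q j (z : circle R) := sqmod (trig_eval (annihilating_seq 2 alpha (n_ j)) (val z)).
have mv j : measurable_fun setT (v j) by exact: measurable_sqmod_trig_eval.
have mq j : measurable_fun setT (q j) by exact: measurable_sqmod_trig_eval.
have v0 j z : 0 <= v j z by exact: sqmod_ge0.
have q0 j z : 0 <= q j z by exact: sqmod_ge0.
have vq j z : 1 / 4 * (c ^+ 2 / 4) <= (c ^+ 2 + 1) ^+ 2 * v j z + q j z.
  rewrite /v /q /V /annihilating_seq !trig_eval_dilate trig_eval_mul !trig_eval_sub.
  exact: sqmod_annihilator_lower.
(* The separating set is where $\sum_j |V(z)|^2$ converges along the subsequence. By [vq] the sum of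
   $|P(z)|^2$ diverges there, which happens only on a null set of [sigma]; the complement is null
   for Lebesgue measure. *)
exists (~` (esum_seq v @^-1` [set +oo%E])); split.
- by apply: measurableC; exact: measurable_esum_seq_infty.
- have mq_oo := measurable_esum_seq_infty mq q0.
  have : sigma (setT `&` esum_seq q @^-1` [set +oo%E]) = 0%E.
    apply: summable_null => // j.
    rewrite /q (spectral_identity mu_inv F_L2 F_sigma).
    by have [] := n_P j.
  rewrite setTI; apply: subset_measure0 => //.
    by apply: measurableC; exact: measurable_esum_seq_infty.
  move=> z /= /(esum_seq_fin_bound v0)[A vA]; apply: contrapT.
  move=> /(esum_seq_fin_bound q0)[B qB].
  pose k := 1 / 4 * (c ^+ 2 / 4).
  have k0 : 0 < k by rewrite mulr_gt0// divr_gt0.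
  (* So many terms, each at least [k] by [vq], exceed the bound forced by convergence of both
     series. *)
  pose J := (Num.truncn (((c ^+ 2 + 1) ^+ 2 * A + B) / k)).+1.
  have : k * J%:R <= (c ^+ 2 + 1) ^+ 2 * A + B.
    apply: (@le_trans _ _ (\sum_(0 <= j < J) ((c ^+ 2 + 1) ^+ 2 * v j z + q j z))).
      rewrite mulr_natr -[X in _ *+ X]subn0 -sumr_const_nat.
      by apply: ler_sum => j _; exact: vq.
    by rewrite big_split -mulr_sumr; apply: lerD => //; rewrite ler_wpM2l// sqr_ge0.
  rewrite leNgt => /negP; apply.
  by rewrite [ltRHS]mulrC -ltr_pdivrMr// truncnS_gt.
- rewrite setCK /lebesgue_circle.
  have := @summable_null _ _ R (@lebesgue_measure R) `[0, 1[%classic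
    (measurable_itv _) (fun j t => v j (expi (2 * pi * t))) _ _ _.
  apply.
  + by move=> j; exact: measurableT_comp (mv j) (@measurable_expi R).
  + by move=> j t; exact: v0.
  + move=> j; have [nj _ le_j] := n_P j.
    by rewrite /v (integral_sqmod_mean R (k := 2) _ nj)// lee_fin.
Qed.

End Singular.

Theorem mainTheorem8 (R : realType) (mu : probability borel_shift R)
    (mu_inv : invariant_on (subshift zeta) mu)
    (sigma_max : {finite_measure set (circle R) -> \bar R})
    (sigma_maxP : in_maximal_spectral_type mu sigma_max) :
  mutually_singular sigma_max (@lebesgue_circle R).
Proof.
have [F [sigma_F [F_L2 F_sigma _ [max_F _]]]] := sigma_maxP.
have [N [mN sigmaN lebN]] := spectral_measure_singular mu_inv F_L2 F_sigma.
exists N; split=> //.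
by have /null_content_dominatesP := max_F; apply.
Qed.
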